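(* Let $L \in \mathbb{R}_{>0}$, $N \in \mathbb{R}_{\ge 0}$ and $\alpha \in (1,4]$. Consider the super-twisting differentiator \begin{align*} \dot y_1 &= \lambda_1 \sqrt{L}\, \lfloor u - y_1 \rceil^{1/2} + y_2, & y_1(0) &= u(0),\\ \dot y_2 &= \lambda_2 L\, \lfloor u - y_1 \rceil^{0}, & y_2(0) &= 0,\\ y &= y_2, \end{align*} with parameters $\lambda_1,\lambda_2>0$ satisfying $$1 < \frac{\lambda_1}{\sqrt{8(\lambda_2+1)}} < \frac{(\alpha+1)\lambda_2 + \alpha - 1}{2\sqrt{\alpha}\,(\lambda_2+1)}.$$ Then, for each input $u = f + \eta$ with $f \in \mathcal{F}_L$ and $\eta \in \mathcal{E}_N$, there exists a finite time $\tau$ depending only on the initial values $\dot f(0)$ and $\eta(0)$ (and on the fixed parameters) such that (every Filippov solution of the differentiator with this input satisfies) $$|y(t) - \dot f(t)| \le 2\sqrt{\alpha(\lambda_2+1)}\,\sqrt{NL} \quad \text{for all } t \ge \tau.$$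
   Context: For $z,p \in \mathbb{R}$, $\lfloor z \rceil^{p} = |z|^p \operatorname{sign}(z)$; in particular $\lfloor z \rceil^0 = \operatorname{sign}(z)$. Solutions of the differentiator (which has a discontinuous right-hand side) are understood in the sense of Filippov. $\mathcal{F}_L$ is the set of differentiable functions $f:\mathbb{R}_{\ge 0}\to\mathbb{R}$ with Lipschitz continuous first derivative such that $|\ddot f(t)| \le L$ for almost every $t \ge 0$. $\mathcal{E}_N$ is the set of Lebesgue measurable functions $\eta:\mathbb{R}_{\ge 0}\to\mathbb{R}$ with $|\eta(t)| \le N$ for all $t \ge 0$. *)

(* Defs.v *)
From mathcomp Require Import all_boot all_order all_algebra.
From mathcomp Require Import all_classical all_reals all_analysis.
Import Order.TTheory GRing.Theory Num.Theory.
Import numFieldNormedType.Exports.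

Set Implicit Arguments.
Unset Strict Implicit.
Unset Printing Implicit Defensive.

Local Open Scope classical_set_scope.
Local Open Scope ring_scope.

Section defs.
Context {R : realType}.

(* signed power  floor(z)ceil^p = |z|^p sign(z);  for p = 0 this is sign(z)
   (powR 0 0 = 1, Num.sg 0 = 0). *)
Definition spow (z p : R) : R := (`|z| `^ p) * Num.sg z.

(* Lebesgue measurable subset of R: differs from a Borel set by a
   Lebesgue-null set (= measurable for the completed Lebesgue measure). *)
Definition lebesgue_measurable_set (A : set R) : Prop :=
  exists B : set R, measurable B /\
    (@lebesgue_measure R).-negligible ((A `\` B) `|` (B `\` A)).

Definition class_F (L : R) (f : R -> R) : Prop :=
  (forall t, 0 <= t -> derivable f t 1) /\
  (exists K : R, forall s t : R, 0 <= s -> 0 <= t ->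
      `|derive1 f s - derive1 f t| <= K * `|s - t|) /\
  {ae (@lebesgue_measure R), forall t, 0 < t ->
      derivable (derive1 f) t 1 /\ `|derive1 (derive1 f) t| <= L}.

Definition class_E (N : R) (eta : R -> R) : Prop :=
  (forall B : set R, measurable B ->
     lebesgue_measurable_set (`[0, +oo[ `&` (eta @^-1` B))) /\
  (forall t, 0 <= t -> `|eta t| <= N).

Definition conv_hull (A : set (R * R)) : set (R * R) :=
  [set v | exists (n : nat) (w : 'I_n -> R) (a : 'I_n -> R * R),
      (forall i, 0 <= w i) /\ \sum_(i < n) w i = 1 /\
      (forall i, A (a i)) /\ v = \sum_(i < n) w i *: a i].

Definition null2 (M : set (R * R)) : Prop :=
  ((@lebesgue_measure R) \x (@lebesgue_measure R))%E.-negligible M.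

Definition filippov_set (F : R -> R * R -> R * R) (t : R) (x : R * R)
  : set (R * R) :=
  [set v | forall (delta : R) (M : set (R * R)), 0 < delta -> null2 M ->
      closure (conv_hull (F t @` (ball x delta `\` M))) v].

(* y : [0,+oo) -> R^2 is a (forward complete) Filippov solution of x' = F(t,x):
   it is absolutely continuous on every [0,t], i.e. y(t) = y(0) + \int_0^t g
   with g locally integrable, and g(t) = y'(t) lies in K[F](t, y(t)) for
   almost every t >= 0. *)
Definition filippov_solution (F : R -> R * R -> R * R) (y : R -> R * R)
  : Prop :=
  exists g : R -> R * R,
    (forall t, 0 <= t ->
       (@lebesgue_measure R).-integrable `[0%R, t] (fun s => ((g s).1)%:E) /\
       (@lebesgue_measure R).-integrable `[0%R, t] (fun s => ((g s).2)%:E) /\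
       ((y t).1 - (y 0).1)%:E =
         (\int[@lebesgue_measure R]_(s in `[0%R, t]) ((g s).1)%:E)%E /\
       ((y t).2 - (y 0).2)%:E =
         (\int[@lebesgue_measure R]_(s in `[0%R, t]) ((g s).2)%:E)%E) /\
    {ae (@lebesgue_measure R), forall t, 0 <= t -> filippov_set F t (y t) (g t)}.

Definition sta_rhs (lambda1 lambda2 L : R) (u : R -> R) (t : R) (x : R * R)
  : R * R :=
  (lambda1 * Num.sqrt L * spow (u t - x.1) (2^-1) + x.2,
   lambda2 * L * spow (u t - x.1) 0).

End defs.

(* Main.v *)
Require Import Defs.
From mathcomp Require Import all_boot all_order all_algebra.
From mathcomp Require Import all_classical all_reals all_analysis.
From mathcomp Require Import measurable_realfun ring lra.
Import Order.TTheory GRing.Theory Num.Theory.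
Import numFieldNormedType.Exports.
Local Open Scope classical_set_scope.
Local Open Scope ring_scope.

(* Write z = (y1 - f, y2 - f') / L and n = N / L.  The function V below is the
   maximum of m^2 z2^2 / 2, psi(z2) - z1 and psi(- z2) + z1, where
   psi(s) = m^2 s^2 for s >= 0 and psi(s) = - 4 s^2 / lambda1^2 for s < 0.  On
   the region V >= n / (1 - g^2), every branch of V that attains the maximum
   decreases along the differential inclusion at rate at least eps sqrt V:
   - on m^2 z2^2 / 2 the sign term acts against z2, since |z1| > n there;
   - on the parabola psi(z2) - z1, z2 >= 0, the worst noise either freezes z1' at
     z2, or pushes z1 back with strength sqrt (z1 + n); the strict upper bound
     on lambda1 allows m^2 to be slightly larger than
     1 / (2 alpha (lambda2 + 1)) while both cases still decrease;
   - on the ray, z2 < 0, the decrease comes from lambda1^2 > 8 (lambda2 + 1).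
   Hence sqrt V decreases linearly until V <= n / (1 - g^2), in a time that
   depends on z(0) only, and V then stays there.  As m^2 exceeds
   1 / (2 alpha (lambda2 + 1)), g > 0 can be chosen so that this bound on V is
   the claimed bound on z2.  V is not differentiable, and z is
   differentiable only almost everywhere, so the decrease is expressed by upper
   right Dini derivatives outside of a null set. *)

(** * A barrier argument with Dini derivatives *)

(** Continuous induction: the supremum of the times up to which [P] holds throughout is itself such
    a time by the left-hand rule, and below [T] the right-hand rule would push past it. *)
Lemma real_induction (R : realType) (T : R) (P : R -> Prop) :
  0 <= T -> P 0 ->
  (forall t : R, 0 <= t -> t < T -> (forall s : R, 0 <= s -> s <= t -> P s) ->
     \forall h \near (0:R)^'+, P (t + h)) ->
  (forall t : R, 0 < t -> t <= T -> (forall s : R, 0 <= s -> s < t -> P s) -> P t) ->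
  P T.
Proof.
move=> T0 P0 Pright Pleft.
pose A := [set t : R | [/\ 0 <= t, t <= T & forall s : R, 0 <= s -> s <= t -> P s]].
have A0 : A 0 by split => // s s0 s0'; have -> : s = 0 by apply/le_anti/andP.
have supA : has_sup A by split; [exists 0|exists T => t []].
have S0 : 0 <= sup A by apply: sup_upper_bound.
have ST : sup A <= T by apply: ge_sup => [|t []//]; exists 0.
have PS s : 0 <= s -> s < sup A -> P s.
  move=> s0 sS; have [t At st] : exists2 t, A t & s < t.
    by have [t At] := sup_adherent (eps := sup A - s) (ltac:(by rewrite subr_gt0)) supA;
      rewrite subKr => ?; exists t.
  by case: At => _ _; apply => //; exact: ltW.
have PSS : P (sup A).
  move: S0; rewrite le_eqVlt => /predU1P[<-//|S0].
  exact: Pleft.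
have PS' s : 0 <= s -> s <= sup A -> P s.
  by move=> s0; rewrite le_eqVlt => /predU1P[->//|]; exact: PS.
have [TS|{}ST] := leP T (sup A); first by apply: PS'.
have [d /= d0 Pd] := Pright _ S0 ST PS'.
(* Half of [d] stays strictly inside the neighbourhood; the cap keeps [sup A + e] within [T]. *)
pose e := Num.min (d / 2) (T - sup A).
have e0 : 0 < e by rewrite lt_min divr_gt0// subr_gt0.
have : A (sup A + e).
  split; first by rewrite addr_ge0// ltW.
    by rewrite -lerBrDl ge_min lexx orbT.
  move=> s s0 se; have [sS|Ss] := leP s (sup A); first exact: PS'.
  rewrite -(subrKC (sup A) s); apply: Pd; last by rewrite subr_gt0.
  rewrite /ball_/= sub0r normrN gtr0_norm ?subr_gt0//.
  rewrite ltrBlDl (le_lt_trans se)// ltrD2l /e gt_min ltr_pdivrMr//.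
  by rewrite ltr_pMr// ltr1n.
by move/(sup_upper_bound supA); rewrite gerDl leNgt e0.
Qed.

Lemma negligible_open_cover (R : realType) (E : set R) (eta : R) :
  (@lebesgue_measure R).-negligible E -> 0 < eta ->
  exists U : set R, [/\ open U, E `<=` U & (@lebesgue_measure R U < eta%:E)%E].
Proof.
move=> [B [mB B0 EB]] eta0.
have [|U [oU BU UB]] := lebesgue_regularity_outer mB _ eta0.
  by move: B0 => /= ->; exact: ltry.
exists U; split => //; first exact: subset_trans BU.
rewrite -(setDKU BU) (le_lt_trans (measureU2 _ _ _))//.
  by apply: measurableD => //; exact: open_measurable.
by rewrite [X in (_ + X)%E]B0 adde0.
Qed.

(* The excess over the barrier accumulated near the exceptional set is charged
   to the measure of a small open neighbourhood of that set. *)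
Lemma dini_barrier (R : realType) (w : R -> R) (T eps K C : R) (E : set R) :
  0 <= T -> 0 <= eps ->
  (forall t : R, 0 <= t -> t <= T -> forall e : R, 0 < e -> exists2 d : R, 0 < d &
     forall s : R, 0 <= s -> s <= T -> `|s - t| < d -> `|w s - w t| < e) ->
  (@lebesgue_measure R).-negligible E ->
  (forall t : R, 0 <= t -> t < T -> C < w t -> ~ E t -> forall s : R, 0 < s ->
     \forall h \near (0:R)^'+, w (t + h) <= w t + (s - eps) * h) ->
  (forall t : R, 0 <= t -> t < T -> C < w t ->
     \forall h \near (0:R)^'+, w (t + h) <= w t + K * h) ->
  w T <= Num.max C (w 0 - eps * T).
Proof.
move=> T0 eps0 wcont negE wE wK.
pose mu := @lebesgue_measure R.
wlog K0 : K wK / 0 <= K.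
  move=> /(_ `|K|); apply => // t t0 tT Ct.
  have := wK t t0 tT Ct; apply: filterS2 (nbhs_right_gt 0) => h h0 /le_trans; apply.
  by rewrite lerD2l ler_wpM2r ?ler_norm// ltW.
(* The total surplus is [th * (T + 1 + K + eps)], which vanishes with [th]. *)
suff main th : 0 < th ->
    w T <= Num.max C (w 0 - eps * T) + th * (T + 1) + (K + eps) * th.
  apply/ler_addgt0Pr => e e0.
  have k0 : 0 < T + 1 + (K + eps) by rewrite ltr_wpDr ?addr_ge0// ltr_wpDl.
  have := main _ (divr_gt0 e0 k0); rewrite -addrA => /le_trans; apply.
  by rewrite lerD2l mulrC -mulrDl mulrCA divff ?mulr1// gt_eqF.
move=> th0.
have [U [oU EU muU]] := negligible_open_cover R E th negE th0.
have mU : measurable U by exact: open_measurable.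
pose m (t : R) := fine (mu (U `&` `[0, t])).
have mfin t : mu (U `&` `[0, t]) \is a fin_num.
  rewrite ge0_fin_numE//; apply: le_lt_trans (lt_trans muU (ltry _)).
  by apply: le_measure; rewrite ?inE//; exact: measurableI.
have mE t : mu (U `&` `[0, t]) = (m t)%:E by rewrite fineK.
have m0 t : 0 <= m t by rewrite fine_ge0.
have m_th t : m t <= th.
  rewrite -lee_fin -mE ltW//; apply: le_lt_trans muU.
  by apply: le_measure; rewrite ?inE//; exact: measurableI.
have m_nd (s t : R) : s <= t -> m s <= m t.
  move=> st; rewrite -lee_fin -!mE; apply: le_measure.
  - by rewrite inE; exact: measurableI.
  - by rewrite inE; exact: measurableI.
  - by apply: setIS; apply: subset_itvl; rewrite bnd_simp.
(* Since [U] is open, [m] grows at unit rate to the right of each of its points, hence of each point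
   of [E]. *)
have m_inc (t : R) : 0 <= t -> U t -> \forall h \near (0:R)^'+, m t + h <= m (t + h).
  move=> t0 Ut; have [d /= d0 dU] := oU _ Ut.
  near=> h; have h0 : 0 < h by [].
  have hd : h < d by [].
  have sub (s : R) : ((U `&` `[0, t]) `|` `]t, t + h]) s -> (U `&` `[0, t + h]) s.
    move=> [[Us]|]/=; rewrite !in_itv/= => /andP[s1 s2].
      by split => //=; rewrite s1 (le_trans s2)// lerDl ltW.
    split; last by rewrite s2 (le_trans t0)// ltW.
    apply: dU; rewrite /ball_/= distrC gtr0_norm ?subr_gt0//.
    by rewrite ltrBlDl (le_lt_trans s2)// ltrD2l.
  have disj (s : R) : (U `&` `[0, t] `&` `]t, t + h]) s -> False.
    move=> [[_]]/=; rewrite !in_itv/= => /andP[_ st] /andP[ts _].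
    by move: (lt_le_trans ts st); rewrite ltxx.
  rewrite -lee_fin -mE EFinD -mE.
  have -> : h%:E = mu (`]t, t + h]%classic : set R).
    rewrite /mu lebesgue_measure_itv/= lte_fin ltrDl h0 -EFinD.
    by congr EFin; ring.
  rewrite -measureU//.
  - apply: le_measure; rewrite ?inE//.
    + by apply: measurableU => //; exact: measurableI.
    + exact: measurableI.
  - exact: measurableI.
  - by rewrite -subset0 => s; exact: disj.
(* The barrier: [th * (t + 1)] gives a slack of at least [th] and an extra slope [th];
   [(K + eps) * m t] rises at slope [K + eps] on [U], which pays for a slope [K] instead of [- eps]
   on [E]. *)
pose B (t : R) := Num.max C (w 0 - eps * t) + th * (t + 1) + (K + eps) * m t.
suff : w T <= B T.
  by move/le_trans; apply; rewrite lerD2l ler_wpM2l// addr_ge0.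
have maxdec (t h : R) : 0 <= h ->
    Num.max C (w 0 - eps * t) - eps * h <= Num.max C (w 0 - eps * (t + h)).
  move=> h0; rewrite lerBlDr ge_max; apply/andP; split.
    by rewrite (@le_trans _ _ (C + eps * h)) ?lerDl ?mulr_ge0// lerD2r le_max lexx.
  rewrite (@le_trans _ _ (w 0 - eps * (t + h) + eps * h))//.
    by rewrite mulrDr; lra.
  by rewrite lerD2r le_max lexx orbT.
apply: (@real_induction _ T (fun t => w t <= B t)) => //.
- rewrite /B mulr0 subr0 add0r mulr1 -addrA (@le_trans _ _ (Num.max C (w 0)))//.
    by rewrite le_max lexx orbT.
  by rewrite lerDl addr_ge0 ?(ltW th0)// mulr_ge0 // addr_ge0.
- move=> t t0 tT IH.
  have wB : w t <= B t by exact: IH.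
  (* At or below [C], continuity and the slack [th] suffice. *)
  have [Cw|wC] := ltP C (w t); last first.
    have [d d0 dw] := wcont t t0 (ltW tT) _ th0.
    near=> h; have h0 : 0 < h by [].
    have : `|w (t + h) - w t| < th.
      apply: dw; first by rewrite addr_ge0// ltW.
        by rewrite -lerBrDl ltW//; near: h; apply: nbhs_right_lt; rewrite subr_gt0.
      by rewrite addrC addKr gtr0_norm//; near: h; exact: nbhs_right_lt.
    rewrite ltr_norml => /andP[_ wth].
    have : C <= Num.max C (w 0 - eps * (t + h)) by rewrite le_max lexx.
    have : 0 <= (K + eps) * m (t + h) by rewrite mulr_ge0 // addr_ge0.
    have : 0 <= th * (t + h) by rewrite mulr_ge0 ?(ltW th0)// addr_ge0// ltW.
    by rewrite /B; lra.
  have [Et|nEt] := pselect (E t).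
    near=> h; have h0 : 0 < h by [].
    have mh : m t + h <= m (t + h).
      by near: h; apply: m_inc => //; exact: EU.
    have wh : w (t + h) <= w t + K * h by near: h; exact: wK.
    have := maxdec t h (ltW h0).
    have := ler_wpM2l (addr_ge0 K0 eps0) mh.
    have := mulr_ge0 (ltW th0) (ltW h0).
    by move: wB; rewrite /B; lra.
  near=> h; have h0 : 0 < h by [].
  have mh : m t <= m (t + h) by apply: m_nd; rewrite lerDl ltW.
  have wh : w (t + h) <= w t + (th - eps) * h by near: h; exact: wE.
  have := maxdec t h (ltW h0).
  have := ler_wpM2l (addr_ge0 K0 eps0) mh.
  by move: wB; rewrite /B; lra.
(* Closure from the left: continuity costs [e / 2], and the barrier descends by at most
   [eps * h <= e / 2] over the step [h]. *)
- move=> t t0 tT IH; apply/ler_addgt0Pr => e e0.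
  have [d d0 dw] := wcont t (ltW t0) tT _ (divr_gt0 e0 (ltr0Sn _ 1)).
  pose k := eps + 1.
  have k0 : 0 < k by rewrite ltr_wpDl.
  near (0:R)^'+ => h; have h0 : 0 < h by [].
  have ht : h < t by [].
  have := dw (t - h).
  have -> : t - h - t = - h by ring.
  rewrite normrN gtr0_norm// subr_ge0 (ltW ht).
  have hT : t - h <= T by rewrite (le_trans _ tT)// gerBl ltW.
  have hd : h < d by [].
  move=> /(_ isT hT hd); rewrite ltr_norml => /andP[wth _].
  have : w (t - h) <= B (t - h) by apply: IH; [rewrite subr_ge0 ltW|rewrite gtrBl].
  have mh : m (t - h) <= m t by apply: m_nd; rewrite gerBl ltW.
  have := ler_wpM2l (addr_ge0 K0 eps0) mh.
  have := maxdec (t - h) h (ltW h0); rewrite subrK.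
  have : eps * h <= e / 2.
    rewrite (@le_trans _ _ (k * h))//; first by rewrite ler_wpM2r ?(ltW h0)// lerDl.
    rewrite mulrC -ler_pdivlMr//; near: h; apply: nbhs_right_le.
    by rewrite !divr_gt0.
  have := mulr_ge0 (ltW th0) (ltW h0).
  by rewrite /B; lra.
Unshelve. all: by end_near. Qed.

(** * Decay of the branches of the Lyapunov function *)

(** This is psi for [a = m ^ 2] and [b = 4 / lambda1 ^ 2]. The two half-parabolas meet with slope 0
    at the origin, so [dsqabs] is the derivative everywhere. *)
Definition sqabs {R : realType} (a b s : R) : R :=
  if 0 <= s then a * s ^+ 2 else - (b * s ^+ 2).

Definition dsqabs {R : realType} (a b s : R) : R :=
  if 0 <= s then 2 * a * s else - (2 * b * s).

(* Velocities of the normalised error z = (y1 - f, y2 - f') / L, where e is the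
   argument of the sign functions and s a selection of the Filippov sign. *)
Definition error_field {R : realType} (l1 l2 n : R) (z1 z2 v1 v2 : R) : Prop :=
  exists e s d : R,
    [/\ `|e + z1| <= n, v1 = l1 * (Num.sg e * Num.sqrt `|e|) + z2,
        v2 = l2 * s + d, `|d| <= 1 &
        [/\ `|s| <= 1, 0 < e -> s = 1 & e < 0 -> s = -1]].

(** The inclusion is odd, so each branch of V and its mirror image need one computation only. *)
Lemma error_fieldN {R : realType} (l1 l2 n z1 z2 v1 v2 : R) :
  error_field l1 l2 n z1 z2 v1 v2 ->
  error_field l1 l2 n (- z1) (- z2) (- v1) (- v2).
Proof.
move=> [e [s [d [ez -> -> d1 [s1 sp sn]]]]].
exists (- e), (- s), (- d); split.
- by rewrite -opprD normrN.
- by rewrite sgrN normrN; ring.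
- by ring.
- by rewrite normrN.
split; first by rewrite normrN.
- by rewrite oppr_gt0 => /sn ->; rewrite opprK.
- by rewrite oppr_lt0 => /sp ->.
Qed.

Lemma ler_sum_sqrt {R : realType} (e x y : R) :
  0 <= e -> 0 <= x -> 0 <= y -> y ^+ 2 <= e + x ^+ 2 -> y <= Num.sqrt e + x.
Proof.
move=> e0 x0 y0 h; rewrite -(@ler_pXn2r _ 2) ?nnegrE ?addr_ge0//.
apply: (le_trans h); rewrite sqrrD sqr_sqrtr//.
by rewrite lerD2r lerDl mulrn_wge0// mulr_ge0.
Qed.

Section decay.
Context {R : realType} {l1 l2 m g b : R}.
Context (l10 : 0 < l1) (l21 : 1 < l2) (l1l2 : 8 * (l2 + 1) < l1 ^+ 2)
  (m0 : 0 < m) (m_l2 : 2 * m ^+ 2 * (l2 + 1) < 1)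
  (m_l1 : l1 * m < 1 + 2 * m ^+ 2 * (l2 - 1)) (g0 : 0 < g)
  (bE : b * l1 ^+ 2 = 4).

(** Here [r] stands for the square root of V. The two conditions on [z1] and [z2] give
    [z1 >= r ^+ 2 > n], so [e < 0] and [s = -1]; then [v2 <= 1 - l2 < 0] while [m * z2 >= r]. *)
Lemma decay_top : exists2 eps, 0 < eps & forall n r z1 z2 v1 v2 : R,
  0 <= n -> 0 < r -> g ^+ 2 * r ^+ 2 <= r ^+ 2 - n -> 0 <= z2 ->
  error_field l1 l2 n z1 z2 v1 v2 ->
  m ^+ 2 / 2 * z2 ^+ 2 = r ^+ 2 -> m ^+ 2 * z2 ^+ 2 - z1 <= r ^+ 2 ->
  m ^+ 2 * z2 * v2 <= - (eps * r).
Proof.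
exists ((l2 - 1) * m); first by rewrite mulr_gt0// subr_gt0.
move=> n r z1 z2 v1 v2 n0 r0 gr z20 [e [s [d [ez _ -> d1 [_ _ sn]]]]] A B.
have gr0 : 0 < g ^+ 2 * r ^+ 2 by rewrite mulr_gt0// exprn_gt0.
have e0 : e < 0 by move: ez; rewrite ler_norml => /andP[_ ez]; lra.
have {}d1 : d <= 1 by move: d1; rewrite ler_norml => /andP[].
rewrite (sn e0).
have mz : r <= m * z2.
  rewrite -(@ler_pXn2r _ 2) ?nnegrE ?mulr_ge0 ?(ltW m0) ?(ltW r0)// exprMn.
  have : 0 <= r ^+ 2 by rewrite exprn_ge0// ltW.
  by lra.
have h1 : 0 <= m * (m * z2) * ((1 - l2) - (l2 * -1 + d)).
  by rewrite mulr_ge0 ?mulr_ge0 ?(ltW m0)//; lra.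
have h2 : 0 <= (l2 - 1) * m * (m * z2 - r).
  by rewrite mulr_ge0 ?subr_ge0// mulr_ge0 ?(ltW m0)// subr_ge0 ltW.
by lra.
Qed.

(** For [e < 0] the noise bound gives [sqrt (- e) <= m * z2], and [m_l1] decides the sign. For
    [e >= 0] the value of [v2] may reach [l2 + 1]; then [m_l2] decides, and [l1 * sqrt e] makes up
    for a small [z2]. *)
Lemma decay_parabola : exists2 eps, 0 < eps & forall n r z1 z2 v1 v2 : R,
  0 <= n -> 0 < r -> g ^+ 2 * r ^+ 2 <= r ^+ 2 - n -> 0 <= z2 ->
  error_field l1 l2 n z1 z2 v1 v2 -> m ^+ 2 * z2 ^+ 2 - z1 = r ^+ 2 ->
  2 * m ^+ 2 * z2 * v2 - v1 <= - (eps * r).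
Proof.
(* A common rate: the third bound serves [e >= 0], the fourth [e < 0], and [k <= l1] lets the
   [sqrt e] term contribute. *)
have [k [k0 kl1 km1 km2]] : exists k, [/\ 0 < k, k <= l1,
    k * m <= 1 - 2 * m ^+ 2 * (l2 + 1) &
    k * m <= 1 + 2 * m ^+ 2 * (l2 - 1) - l1 * m].
  exists (Num.min l1 (Num.min ((1 - 2 * m ^+ 2 * (l2 + 1)) / m)
                      ((1 + 2 * m ^+ 2 * (l2 - 1) - l1 * m) / m))).
  split.
  - by rewrite !lt_min l10 !divr_gt0// subr_gt0.
  - by rewrite ge_min lexx.
  - by rewrite -ler_pdivlMr// !ge_min lexx orbT.
  - by rewrite -ler_pdivlMr// !ge_min lexx !orbT.
exists (k * g); first by rewrite mulr_gt0.
move=> n r z1 z2 v1 v2 n0 r0 gr z20 [e [s [d [ez -> -> d1 [s1 sp sn]]]]] B.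
have gr0 : 0 < g * r by rewrite mulr_gt0.
move: ez; rewrite ler_norml => /andP[ez1 ez2].
have {}d1 : d <= 1 by move: d1; rewrite ler_norml => /andP[].
have {}s1 : s <= 1 by move: s1; rewrite ler_norml => /andP[].
have mz0 : 0 <= m * z2 by rewrite mulr_ge0// ltW.
have mmz0 : 0 <= 2 * m ^+ 2 * z2.
  by rewrite mulr_ge0// mulr_ge0// exprn_ge0// ltW.
have [e0|e0] := ltP e 0.
  rewrite (sn e0) ltr0_sg// ltr0_norm//.
  have q0 : 0 <= Num.sqrt (- e) by exact: sqrtr_ge0.
  have qe : Num.sqrt (- e) ^+ 2 = - e by rewrite sqr_sqrtr// oppr_ge0 ltW.
  have qm : Num.sqrt (- e) <= m * z2.
    rewrite -(@ler_pXn2r _ 2) ?nnegrE// exprMn qe.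
    have : 0 < (g * r) ^+ 2 by rewrite exprn_gt0.
    by rewrite exprMn; lra.
  have grm : g * r <= m * z2.
    by rewrite -(@ler_pXn2r _ 2) ?nnegrE ?(ltW gr0)// !exprMn; lra.
  have h1 : 0 <= 2 * m ^+ 2 * z2 * ((1 - l2) - (l2 * -1 + d)).
    by rewrite mulr_ge0//; lra.
  have h2 : 0 <= l1 * (m * z2 - Num.sqrt (- e)).
    by rewrite mulr_ge0 ?subr_ge0// ltW.
  have h3 : 0 <= k * (m * z2 - g * r) by rewrite mulr_ge0 ?subr_ge0// ltW.
  have h4 : k * m * z2 <= (1 + 2 * m ^+ 2 * (l2 - 1) - l1 * m) * z2.
    by rewrite ler_wpM2r.
  by lra.
have ve : Num.sg e * Num.sqrt `|e| = Num.sqrt e.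
  move: e0; rewrite le_eqVlt => /predU1P[<-|e0].
    by rewrite normr0 sqrtr0 mulr0.
  by rewrite gtr0_sg// mul1r gtr0_norm.
(* As [e >= - n - z1 >= (g r)^2 - (m z2)^2], the two terms cannot both be small. *)
have grq : g * r <= Num.sqrt e + m * z2.
  by apply: ler_sum_sqrt => //; [exact: ltW|rewrite !exprMn; lra].
rewrite ve.
have h1 : 0 <= 2 * m ^+ 2 * z2 * (l2 + 1 - (l2 * s + d)).
  rewrite mulr_ge0//.
  have : 0 <= l2 * (1 - s) by rewrite mulr_ge0 ?subr_ge0// (le_trans ler01)// ltW.
  by lra.
have h3 : 0 <= k * (Num.sqrt e + m * z2 - g * r).
  by rewrite mulr_ge0 ?subr_ge0// ltW.
have h4 : k * Num.sqrt e <= l1 * Num.sqrt e by rewrite ler_wpM2r ?sqrtr_ge0.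
have h5 : k * m * z2 <= (1 - 2 * m ^+ 2 * (l2 + 1)) * z2 by rewrite ler_wpM2r.
by lra.
Qed.

(* Here [8 (l2 + 1) < l1 ^ 2] makes the ray below the z1-axis repelling. *)
Lemma decay_ray : exists2 eps, 0 < eps & forall n r z1 z2 v1 v2 : R,
  0 <= n -> 0 < r -> g ^+ 2 * r ^+ 2 <= r ^+ 2 - n -> z2 < 0 ->
  error_field l1 l2 n z1 z2 v1 v2 -> - (b * z2 ^+ 2) - z1 = r ^+ 2 ->
  - (2 * b * z2) * v2 - v1 <= - (eps * r).
Proof.
have l1sq : 0 < l1 ^+ 2 by rewrite exprn_gt0.
have b0 : 0 < b by rewrite -(pmulr_lgt0 _ l1sq) bE.
(* [th = 8 (l2 + 1) / l1 ^ 2 < 1]; the fraction [(1 - th) / 2] is what remains of [l1 * sqrt e] once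
   it has absorbed [- (1 + th) * z2]. *)
have [th thE] : exists th, 2 * b * (l2 + 1) = th by exists (2 * b * (l2 + 1)).
have th0 : 0 < th by rewrite -thE !mulr_gt0// addr_gt0// (lt_trans ltr01).
have th1 : th < 1.
  have : 0 < b * (l1 ^+ 2 - 8 * (l2 + 1)) by rewrite mulr_gt0 ?subr_gt0.
  by rewrite mulrBr bE; lra.
exists ((1 - th) / 2 * l1 * g).
  by rewrite mulr_gt0// mulr_gt0// divr_gt0// subr_gt0.
move=> n r z1 z2 v1 v2 n0 r0 gr z20 [e [s [d [ez -> -> d1 [_ sp _]]]]] B.
have gr0 : 0 < g * r by rewrite mulr_gt0.
move: ez; rewrite ler_norml => /andP[ez1 ez2].
have {}d1 : d <= 1 by move: d1; rewrite ler_norml => /andP[].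
have bz : 0 <= b * z2 ^+ 2 by rewrite mulr_ge0 ?sqr_ge0// ltW.
have eg : (g * r) ^+ 2 + b * z2 ^+ 2 <= e by rewrite exprMn; lra.
have e0 : 0 < e by apply: lt_le_trans eg; rewrite ltr_wpDr// exprn_gt0.
rewrite (sp e0) gtr0_sg// gtr0_norm// mul1r.
have q0 : 0 <= Num.sqrt e by exact: sqrtr_ge0.
have qe : Num.sqrt e ^+ 2 = e by rewrite sqr_sqrtr// ltW.
have gq : g * r <= Num.sqrt e.
  by rewrite -(@ler_pXn2r _ 2) ?nnegrE ?(ltW gr0)// qe; lra.
(* The value of [b] is made for this: [b * z2 ^ 2 <= e] becomes [4 * z2 ^ 2 <= l1 ^ 2 * e]. *)
have zq : - (2 * z2) <= l1 * Num.sqrt e.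
  rewrite -(@ler_pXn2r _ 2) ?nnegrE ?mulr_ge0 ?(ltW l10)//; last by lra.
  rewrite exprMn qe sqrrN exprMn.
  have : b * z2 ^+ 2 <= e by apply: le_trans eg; rewrite lerDr sqr_ge0.
  move=> /(ler_wpM2l (ltW l1sq)).
  by rewrite mulrA [l1 ^+ 2 * b]mulrC bE -natrX.
have h1 : 0 <= - (2 * b * z2) * (l2 + 1 - (l2 * 1 + d)).
  by rewrite mulr_ge0//; [rewrite -mulrN mulr_ge0 ?oppr_ge0 ?mulr_ge0 ?(ltW b0) ?(ltW z20)|lra].
have h3 : 2 * b * z2 * (l2 + 1) = th * z2 by rewrite -thE; ring.
have h4 : 0 <= (1 + th) * (l1 * Num.sqrt e + 2 * z2) by rewrite mulr_ge0//; lra.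
have h5 : 0 <= (1 - th) / 2 * l1 * (Num.sqrt e - g * r).
  by rewrite mulr_ge0 ?subr_ge0// mulr_ge0 ?(ltW l10)// divr_ge0// subr_ge0 ltW.
by lra.
Qed.

Lemma decay : exists2 eps, 0 < eps & forall n r z1 z2 v1 v2 : R,
  0 <= n -> 0 < r -> g ^+ 2 * r ^+ 2 <= r ^+ 2 - n ->
  error_field l1 l2 n z1 z2 v1 v2 ->
  (m ^+ 2 / 2 * z2 ^+ 2 = r ^+ 2 ->
   sqabs (m ^+ 2) b z2 - z1 <= r ^+ 2 ->
   sqabs (m ^+ 2) b (- z2) + z1 <= r ^+ 2 ->
   m ^+ 2 * z2 * v2 <= - (eps * r)) /\
  (sqabs (m ^+ 2) b z2 - z1 = r ^+ 2 ->
   dsqabs (m ^+ 2) b z2 * v2 - v1 <= - (eps * r)).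
Proof.
have [e1 e10 H1] := decay_top; have [e2 e20 H2] := decay_parabola.
have [e3 e30 H3] := decay_ray.
pose eps := Num.min e1 (Num.min e2 e3).
have eps1 : eps <= e1 by rewrite ge_min lexx.
have eps2 : eps <= e2 by rewrite !ge_min lexx orbT.
have eps3 : eps <= e3 by rewrite !ge_min lexx !orbT.
exists eps; first by rewrite !lt_min e10 e20.
move=> n r z1 z2 v1 v2 n0 r0 gr ef.
have weak k x : eps <= k -> x <= - (k * r) -> x <= - (eps * r).
  by move=> ek /le_trans; apply; rewrite lerN2 ler_pM2r.
split=> [A B C|B]; rewrite /sqabs /dsqabs in B *.
- apply: (weak e1) => //.
  have [z20|z20] := leP 0 z2.
    by apply: (H1 n r z1 z2 v1 v2) => //; rewrite z20 in B.
  have nz20 : 0 <= - z2 by rewrite oppr_ge0 ltW.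
  rewrite -mulrNN -mulrN; apply: (H1 n r (- z1) _ (- v1)) => //.
  + exact: error_fieldN.
  + by rewrite sqrrN.
  + by move: C; rewrite /sqabs nz20 opprK.
- have [z20|z20] := leP 0 z2.
    by apply: (weak e2) => //; apply: (H2 n r z1) => //; rewrite z20 in B.
  apply: (weak e3) => //; apply: (H3 n r z1) => //.
  by move: B; rewrite leNgt z20.
Qed.

End decay.

(** * Choice of the parameters of the Lyapunov function *)

(** The last inequality turns [m ^ 2 / 2 * z2 ^ 2 * (1 - g ^ 2) <= n] into the claimed
    [z2 ^ 2 <= 4 alpha (l2 + 1) n]. Raising [m] slightly above its critical value makes room for
    [g > 0], and strictness preserves the other constraints. *)
Lemma gain_exists {R : realType} (alpha l1 l2 : R) :
  1 < alpha -> alpha <= 4 -> 0 < l1 -> 0 < l2 ->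
  1 < l1 / Num.sqrt (8 * (l2 + 1)) ->
  l1 / Num.sqrt (8 * (l2 + 1)) <
    ((alpha + 1) * l2 + alpha - 1) / (2 * Num.sqrt alpha * (l2 + 1)) ->
  1 < l2 /\ 8 * (l2 + 1) < l1 ^+ 2 /\
  exists m g : R, [/\ 0 < m, 0 < g < 1, 2 * m ^+ 2 * (l2 + 1) < 1,
    l1 * m < 1 + 2 * m ^+ 2 * (l2 - 1) &
    1 <= m ^+ 2 * (1 - g ^+ 2) * (2 * alpha * (l2 + 1))].
Proof.
move=> a1 a4 l10 l20 H1 H2.
have k0 : 0 < l2 + 1 by lra.
have a0 : 0 < alpha by lra.
set w := Num.sqrt (8 * (l2 + 1)) in H1 H2.
have w0 : 0 < w by rewrite sqrtr_gt0 mulr_gt0.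
have w2 : w ^+ 2 = 8 * (l2 + 1) by rewrite sqr_sqrtr// mulr_ge0 ?ltW.
set q := Num.sqrt alpha in H2.
have q0 : 0 < q by rewrite sqrtr_gt0.
have q2 : q ^+ 2 = alpha by rewrite sqr_sqrtr// ltW.
have q1 : 1 < q by rewrite -(@ltr_pXn2r _ 2) ?nnegrE// ?(ltW q0)// expr1n q2.
have q22 : q <= 2.
  by rewrite -(@ler_pXn2r _ 2) ?nnegrE// ?(ltW q0)// q2 -natrX.
have d0 : 0 < 2 * q * (l2 + 1) by rewrite !mulr_gt0.
have H12 := lt_trans H1 H2.
have H1' : w < l1 by move: H1; rewrite ltr_pdivlMr// mul1r.
move: H12; rewrite ltr_pdivlMr// mul1r -q2 => H12.
(* The chain of bounds reads [0 < l2 (q - 1)^2 + q^2 - 2 q - 1]. For [l2 <= 1] the right side is at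
   most [2 q (q - 2)], which is nonpositive because [alpha <= 4]. *)
have l21 : 1 < l2.
  rewrite ltNge; apply/negP => l2le.
  have h1 : 0 <= (2 - q) * q by rewrite mulr_ge0 ?subr_ge0// ltW.
  have h2 : 0 <= (1 - l2) * (q - 1) ^+ 2 by rewrite mulr_ge0 ?sqr_ge0// subr_ge0.
  by lra.
split=> //; split.
  by rewrite -w2 ltr_pXn2r ?nnegrE// ltW.
(* m0 = 1 / sqrt (2 alpha (l2 + 1)) satisfies the constraints strictly *)
pose m0 := 2 / (q * w).
have qw0 : 0 < q * w by rewrite mulr_gt0.
have m00 : 0 < m0 by rewrite divr_gt0.
have m02 : m0 ^+ 2 * (2 * alpha * (l2 + 1)) = 1.
  rewrite /m0 expr_div_n exprMn q2 w2.
  by field; rewrite !gt_eqF//=.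
have K1 : 2 * m0 ^+ 2 * (l2 + 1) < 1.
  have : 0 < (alpha - 1) * (2 * m0 ^+ 2 * (l2 + 1)).
    by rewrite mulr_gt0 ?subr_gt0// mulr_gt0// mulr_gt0// exprn_gt0.
  by move: m02; clearbody m0; lra.
(* This is the upper bound on [l1 / w], multiplied by [2 / q]. *)
have K2 : l1 * m0 < 1 + 2 * m0 ^+ 2 * (l2 - 1).
  have E1 : l1 * m0 = l1 / w * (2 / q).
    by rewrite /m0; field; rewrite !gt_eqF.
  have E2 : 1 + 2 * m0 ^+ 2 * (l2 - 1) =
     ((alpha + 1) * l2 + alpha - 1) / (2 * q * (l2 + 1)) * (2 / q).
    have -> : m0 ^+ 2 = (2 * alpha * (l2 + 1))^-1.
      have D0 : 2 * alpha * (l2 + 1) != 0 by rewrite gt_eqF// !mulr_gt0.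
      by apply: (mulIf D0); rewrite m02 mulVf.
    by rewrite -q2; field; rewrite !gt_eqF.
  by rewrite E1 E2 ltr_pM2r// divr_gt0.
pose G := 1 + 2 * m0 ^+ 2 * (l2 - 1) - l1 * m0.
have G0 : 0 < G by rewrite subr_gt0.
pose F := 1 - 2 * m0 ^+ 2 * (l2 + 1).
have F0 : 0 < F by rewrite subr_gt0.
(* For [h <= 1], replacing [m0] by [m0 + h] raises [2 m0 ^ 2 (l2 + 1)] by at most [h * c]. *)
pose c := 2 * (2 * m0 + 1) * (l2 + 1).
have c0 : 0 < c by rewrite !mulr_gt0// addr_gt0// mulr_gt0.
near (0:R)^'+ => h.
have h0 : 0 < h by [].
have h1 : h <= 1 by near: h; exact: nbhs_right_le.
have hG : h * l1 < G.
  by rewrite -ltr_pdivlMr//; near: h; apply: nbhs_right_lt; rewrite divr_gt0.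
have hF : h * c < F.
  by rewrite -ltr_pdivlMr//; near: h; apply: nbhs_right_lt; rewrite divr_gt0.
have m0h : 0 < m0 + h by rewrite addr_gt0.
have r01 : 0 < m0 ^+ 2 / (m0 + h) ^+ 2 < 1.
  rewrite divr_gt0 ?exprn_gt0//= ltr_pdivrMr ?exprn_gt0// mul1r.
  by rewrite ltr_pXn2r ?nnegrE ?(ltW m00) ?(ltW m0h)// ltrDl.
have [r0 r1] := andP r01.
(* This [g] makes [m ^ 2 * (1 - g ^ 2)] equal to [m0 ^ 2], so the last inequality becomes the
   equality [m02]. *)
exists (m0 + h), (Num.sqrt (1 - m0 ^+ 2 / (m0 + h) ^+ 2)); split => //.
- rewrite sqrtr_gt0 subr_gt0 r1 /= -(@ltr_pXn2r _ 2) ?nnegrE ?sqrtr_ge0//.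
  by rewrite sqr_sqrtr ?subr_ge0 ?(ltW r1)// expr1n gtrBl; exact: r0.
- have : 0 <= (1 - h) * h * (l2 + 1) by rewrite !mulr_ge0 ?subr_ge0// ltW.
  by move: hF; rewrite /c /F; lra.
- have : 0 <= (2 * m0 * h + h ^+ 2) * (l2 - 1).
    have mh : 0 <= m0 * h by rewrite mulr_ge0// ltW.
    rewrite mulr_ge0 ?subr_ge0 ?(ltW l21)// addr_ge0 ?sqr_ge0// -mulrA.
    by rewrite mulr_ge0.
  by move: hG; rewrite /G; lra.
- rewrite sqr_sqrtr ?subr_ge0 ?(ltW r1)// subKr.
  have mh2 : (m0 + h) ^+ 2 != 0 by rewrite gt_eqF// exprn_gt0.
  have E : (m0 + h) ^+ 2 * (m0 ^+ 2 / (m0 + h) ^+ 2) = m0 ^+ 2.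
    by rewrite mulrC divfK.
  by rewrite E q2 m02.
Unshelve. all: by end_near. Qed.

(** * Decay of the Lyapunov function along error trajectories *)

(** A one-sided Taylor bound that survives the jump of the second derivative at 0. The case not left
    to linear arithmetic is an upward crossing, where [0 <= s + k <= k]. *)
Lemma sqabs_taylor {R : realType} (a b s k : R) : 0 <= a -> 0 <= b ->
  sqabs a b (s + k) <= sqabs a b s + dsqabs a b s * k + (a + b) * k ^+ 2.
Proof.
move=> a0 b0; rewrite /sqabs /dsqabs.
have ask : 0 <= a * (s + k) ^+ 2 by rewrite mulr_ge0// sqr_ge0.
have bsk : 0 <= b * (s + k) ^+ 2 by rewrite mulr_ge0// sqr_ge0.
have ak : 0 <= a * k ^+ 2 by rewrite mulr_ge0// sqr_ge0.
have bk : 0 <= b * k ^+ 2 by rewrite mulr_ge0// sqr_ge0.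
have [s0|s0] := leP 0 s; have [sk0|sk0] := leP 0 (s + k); try by lra.
have : (a + b) * (s + k) ^+ 2 <= (a + b) * k ^+ 2.
  have skk : s + k <= k by rewrite gerDr ltW.
  by rewrite ler_wpM2l ?addr_ge0// ler_pXn2r ?nnegrE// (le_trans sk0).
by lra.
Qed.

Lemma sqabs_lip {R : realType} (a b M s s' D : R) : 0 <= a -> 0 <= b ->
  `|s| <= M -> `|s'| <= M -> `|s' - s| <= D ->
  sqabs a b s' <= sqabs a b s + 4 * (a + b) * M * D.
Proof.
move=> a0 b0 sM s'M sD; have := @sqabs_taylor _ a b s (s' - s) a0 b0.
have D0 : 0 <= D by apply: le_trans sD; exact: normr_ge0.
have M0 : 0 <= M by apply: le_trans sM; exact: normr_ge0.
have ab0 : 0 <= a + b by rewrite addr_ge0.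
rewrite subrKC => /le_trans; apply; rewrite -addrA lerD2l.
(* One half bounds the derivative term, the other the quadratic remainder, where
   [|s' - s| <= 2 M]. *)
have -> : 4 * (a + b) * M * D = 2 * (a + b) * M * D + (a + b) * ((M + M) * D).
  by ring.
apply: lerD; last first.
  rewrite ler_wpM2l// -real_normK ?num_real// expr2 ler_pM//.
  by rewrite (le_trans (ler_normB _ _))// lerD.
rewrite (le_trans (ler_norm _))// normrM ler_pM// /dsqabs.
case: ifPn => _; rewrite ?normrN !normrM ler_pM// ?mulr_ge0//;
  rewrite (ger0_norm (ler0n _ _)) ger0_norm// ler_wpM2l//.
  by rewrite lerDl.
by rewrite lerDr.
Qed.

Definition lyap {R : realType} (a b z1 z2 : R) : R :=
  Num.max (a / 2 * z2 ^+ 2)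
    (Num.max (sqabs a b z2 - z1) (sqabs a b (- z2) + z1)).

Lemma lyap_ge0 {R : realType} (a b z1 z2 : R) : 0 <= a -> 0 <= lyap a b z1 z2.
Proof.
by move=> a0; rewrite /lyap le_max mulr_ge0 ?sqr_ge0// divr_ge0.
Qed.

Lemma lyap_lip {R : realType} (a b M z1 z2 z1' z2' D : R) : 0 <= a -> 0 <= b ->
  `|z2| <= M -> `|z2'| <= M -> `|z1' - z1| <= D -> `|z2' - z2| <= D ->
  lyap a b z1' z2' <= lyap a b z1 z2 + (4 * (a + b) * M + 1) * D.
Proof.
move=> a0 b0 zM z'M D1 D2.
have D0 : 0 <= D by apply: le_trans D2; exact: normr_ge0.
have M0 : 0 <= M by apply: le_trans zM; exact: normr_ge0.
have [D1a D1b] := (ler_normlW D1, ler_normlW D1); move: D1; rewrite ler_norml => /andP[D1 _].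
have aMD : 0 <= a * M * D by rewrite !mulr_ge0.
have bMD : 0 <= b * M * D by rewrite !mulr_ge0.
have lA : a / 2 * z2 ^+ 2 <= lyap a b z1 z2 by rewrite /lyap le_max lexx.
have lB : sqabs a b z2 - z1 <= lyap a b z1 z2 by rewrite /lyap !le_max lexx orbT.
have lC : sqabs a b (- z2) + z1 <= lyap a b z1 z2.
  by rewrite /lyap !le_max lexx !orbT.
rewrite [leLHS]/lyap !ge_max; apply/and3P; split.
- have : z2' ^+ 2 - z2 ^+ 2 <= D * (M + M).
    rewrite subr_sqr (le_trans (ler_norm _))// normrM ler_pM//.
    by rewrite (le_trans (ler_normD _ _))// lerD.
  move=> /(ler_wpM2l a0); rewrite -mulrA in lA *; lra.
- by have := sqabs_lip _ _ _ _ _ _ a0 b0 zM z'M D2; lra.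
- have := sqabs_lip a b M (- z2) (- z2') D a0 b0.
  rewrite !normrN -opprD normrN => /(_ zM z'M D2).
  by lra.
Qed.

(** A right derivative as a little-o bound, free of quotients, ready to enter Dini estimates. *)
Definition right_diff {R : realType} (z : R -> R) (t v : R) : Prop :=
  forall s : R, 0 < s ->
    \forall h \near (0:R)^'+, `|z (t + h) - z t - h * v| <= s * h.

(** A chain rule for upper Dini derivatives: a quadratic upper bound on [G] at [z2 t] is enough. The
    branches of V use [c] equal to 0, -1 and 1. *)
Lemma dini_quad {R : realType} (z1 z2 : R -> R) (t v1 v2 d M c : R)
    (G : R -> R) : 0 <= M -> `|c| <= 1 ->
  right_diff z1 t v1 -> right_diff z2 t v2 ->
  (forall k, G (z2 t + k) <= G (z2 t) + d * k + M * k ^+ 2) ->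
  forall s : R, 0 < s -> \forall h \near (0:R)^'+,
    G (z2 (t + h)) + c * z1 (t + h) <=
    G (z2 t) + c * z1 t + (d * v2 + c * v1 + s) * h.
Proof.
move=> M0 c1 Z1 Z2 GT s s0.
have d1 : 0 < `|d| + 1 by rewrite ltr_wpDl.
(* The surplus [s] is halved: [(|d| + 1) * e] covers the linear errors, and [h * N] covers
   [M * k ^ 2], since [e <= 1] gives [|k| <= (|v2| + 1) h]. *)
pose e := Num.min 1 (s / 2 / (`|d| + 1)).
have e0 : 0 < e by rewrite lt_min ltr01 !divr_gt0.
have e1 : e <= 1 by rewrite ge_min lexx.
have ed : (`|d| + 1) * e <= s / 2.
  by rewrite mulrC -ler_pdivlMr// ge_min lexx orbT.
pose N := M * (`|v2| + 1) ^+ 2 + 1.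
have N0 : 0 < N by rewrite ltr_wpDl// mulr_ge0// sqr_ge0.
near=> h; have h0 : 0 < h by [].
have hN : h * N <= s / 2.
  rewrite -ler_pdivlMr//; near: h; apply: nbhs_right_le; rewrite !divr_gt0//.
have z1h : `|z1 (t + h) - z1 t - h * v1| <= e * h by near: h; exact: Z1.
have z2h : `|z2 (t + h) - z2 t - h * v2| <= e * h by near: h; exact: Z2.
set k := z2 (t + h) - z2 t in z2h.
have -> : z2 (t + h) = z2 t + k by rewrite subrKC.
have -> : z1 (t + h) = z1 t + h * v1 + (z1 (t + h) - z1 t - h * v1) by ring.
set k1 := z1 (t + h) - z1 t - h * v1 in z1h *.
apply: (le_trans (lerD (GT k) (lexx _))).
have ck : c * k1 <= e * h.
  rewrite (le_trans (ler_norm _))// normrM -[leRHS]mul1r ler_pM//.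
have kk : `|k| <= (`|v2| + 1) * h.
  rewrite -(subrK (h * v2) k) (le_trans (ler_normD _ _))// mulrDl addrC mul1r.
  rewrite lerD//; first by rewrite normrM (ger0_norm (ltW h0)) mulrC.
  by rewrite (le_trans z2h)// ler_piMl// ltW.
have dk : d * (k - h * v2) <= `|d| * (e * h).
  by rewrite (le_trans (ler_norm _))// normrM ler_wpM2l.
have Mk : M * k ^+ 2 <= s / 2 * h.
  rewrite (@le_trans _ _ (M * ((`|v2| + 1) * h) ^+ 2))//.
    have vh0 : 0 <= (`|v2| + 1) * h by rewrite mulr_ge0 ?addr_ge0// ltW.
    by rewrite ler_wpM2l// -[k ^+ 2]real_normK ?num_real// ler_pXn2r ?nnegrE.
  rewrite (@le_trans _ _ (h * N * h))//; last by rewrite ler_pM2r.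
  rewrite /N exprMn.
  by have : 0 <= h * h; [rewrite mulr_ge0// ltW|lra].
have := ler_wpM2r (ltW h0) ed.
by lra.
Unshelve. all: by end_near. Qed.

(** A branch attaining the maximum [p] must descend at rate [c]; one strictly below it stays below
    for small [h], whatever its slope. *)
Lemma dini_branch {R : realType} (F : R -> R) (F0 D p c : R) :
  (forall s : R, 0 < s -> \forall h \near (0:R)^'+, F h <= F0 + (D + s) * h) ->
  F0 <= p -> (F0 = p -> D <= - c) ->
  forall s : R, 0 < s -> \forall h \near (0:R)^'+, F h <= p + (s - c) * h.
Proof.
move=> FD; rewrite le_eqVlt => /predU1P[F0p /(_ F0p) Dc s s0|F0p _ s s0].
  near=> h; have h0 : 0 < h by [].
  have : F h <= F0 + (D + s) * h by near: h; exact: FD.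
  rewrite F0p => /le_trans; apply; rewrite lerD2l ler_wpM2r ?(ltW h0)//.
  by lra.
pose k := `|D + 1 - s + c| + 1.
have k0 : 0 < k by rewrite ltr_wpDl.
near=> h; have h0 : 0 < h by [].
have : F h <= F0 + (D + 1) * h by near: h; exact: FD.
move=> /le_trans; apply.
have hk : h * k <= p - F0.
  by rewrite -ler_pdivlMr//; near: h; apply: nbhs_right_le; rewrite divr_gt0// subr_gt0.
have : (D + 1 - s + c) * h <= h * k.
  rewrite mulrC ler_wpM2l ?ltW// /k (le_lt_trans (ler_norm _))//.
  by rewrite ltrDl.
by lra.
Unshelve. all: by end_near. Qed.

Lemma lyap_dini {R : realType} (a b c t v1 v2 : R) (z1 z2 : R -> R) :
  0 <= a -> 0 <= b -> right_diff z1 t v1 -> right_diff z2 t v2 ->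
  let p := lyap a b (z1 t) (z2 t) in
  (a / 2 * z2 t ^+ 2 = p -> a * z2 t * v2 <= - c) ->
  (sqabs a b (z2 t) - z1 t = p -> dsqabs a b (z2 t) * v2 - v1 <= - c) ->
  (sqabs a b (- z2 t) + z1 t = p ->
     dsqabs a b (- z2 t) * (- v2) + v1 <= - c) ->
  forall s : R, 0 < s -> \forall h \near (0:R)^'+,
    lyap a b (z1 (t + h)) (z2 (t + h)) <= p + (s - c) * h.
Proof.
move=> a0 b0 Z1 Z2 p HA HB HC s s0.
have ab0 : 0 <= a + b by rewrite addr_ge0.
have lA : a / 2 * z2 t ^+ 2 <= p by rewrite /p /lyap le_max lexx.
have lB : sqabs a b (z2 t) - z1 t <= p by rewrite /p /lyap !le_max lexx orbT.
have lC : sqabs a b (- z2 t) + z1 t <= p.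
  by rewrite /p /lyap !le_max lexx !orbT.
have n0 : `|0 : R| <= 1 by rewrite normr0.
have n1 : `|1 : R| <= 1 by rewrite normr1.
have nN1 : `|-1 : R| <= 1 by rewrite normrN1.
have TA k : a / 2 * (z2 t + k) ^+ 2 <=
    a / 2 * z2 t ^+ 2 + a * z2 t * k + (a + b) * k ^+ 2.
  have : 0 <= (a / 2 + b) * k ^+ 2 by rewrite mulr_ge0 ?sqr_ge0// addr_ge0// divr_ge0.
  by lra.
have TC k : sqabs a b (- (z2 t + k)) <= sqabs a b (- z2 t) +
    - dsqabs a b (- z2 t) * k + (a + b) * k ^+ 2.
  by rewrite opprD mulNr -mulrN -[k ^+ 2]sqrrN sqabs_taylor.
have FA : forall s : R, 0 < s -> \forall h \near (0:R)^'+,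
    a / 2 * z2 (t + h) ^+ 2 + 0 * z1 (t + h) <= p + (s - c) * h.
  apply: dini_branch (dini_quad z1 z2 t v1 v2 _ _ 0
    (fun x => a / 2 * x ^+ 2) ab0 n0 Z1 Z2 TA) _ _; rewrite !mul0r !addr0//.
have FB : forall s : R, 0 < s -> \forall h \near (0:R)^'+,
    sqabs a b (z2 (t + h)) + -1 * z1 (t + h) <= p + (s - c) * h.
  by apply: dini_branch (dini_quad z1 z2 t v1 v2 _ _ (-1) (sqabs a b) ab0 nN1
    Z1 Z2 (fun k => sqabs_taylor a b (z2 t) k a0 b0)) _ _; rewrite !mulN1r.
have FC : forall s : R, 0 < s -> \forall h \near (0:R)^'+,
    sqabs a b (- z2 (t + h)) + 1 * z1 (t + h) <= p + (s - c) * h.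
  by apply: dini_branch (dini_quad z1 z2 t v1 v2 _ _ 1
    (fun x => sqabs a b (- x)) ab0 n1 Z1 Z2 TC) _ _; rewrite !mul1r// mulNr -mulrN.
near=> h.
have A : a / 2 * z2 (t + h) ^+ 2 + 0 * z1 (t + h) <= p + (s - c) * h.
  by near: h; exact: FA.
have B : sqabs a b (z2 (t + h)) + -1 * z1 (t + h) <= p + (s - c) * h.
  by near: h; exact: FB.
have C : sqabs a b (- z2 (t + h)) + 1 * z1 (t + h) <= p + (s - c) * h.
  by near: h; exact: FC.
rewrite mul0r addr0 in A; rewrite mulN1r in B; rewrite mul1r in C.
by rewrite [leLHS]/lyap !ge_max A B C.
Unshelve. all: by end_near. Qed.

(** Concavity: the root lies below its tangent at [r ^ 2]. This carries slope bounds from V over to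
    its square root. *)
Lemma sqrt_tangent {R : realType} (r x : R) : 0 < r -> 0 <= x ->
  Num.sqrt x <= r + (x - r ^+ 2) / (2 * r).
Proof.
move=> r0 x0; have r20 : 0 < 2 * r by rewrite mulr_gt0.
rewrite -lerBlDl ler_pdivlMr//.
have := sqr_sqrtr x0; have := sqr_ge0 (Num.sqrt x - r).
by move=> + <-; rewrite sqrtr_sqr ger0_norm ?sqrtr_ge0//; lra.
Qed.

Lemma sqrt_lt_addr {R : realType} (x y e : R) : 0 <= x -> 0 < e ->
  y < x + e ^+ 2 -> Num.sqrt y < Num.sqrt x + e.
Proof.
move=> x0 e0 yx; have s0 : 0 <= Num.sqrt x + e by rewrite addr_ge0 ?sqrtr_ge0// ltW.
have [y0|y0] := leP y 0.
  by rewrite ler0_sqrtr// ltr_wpDl ?sqrtr_ge0.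
rewrite -(@ltr_pXn2r _ 2) ?nnegrE ?sqrtr_ge0// sqr_sqrtr ?ltW//.
apply: (lt_le_trans yx); rewrite sqrrD sqr_sqrtr// lerD2r lerDl.
by rewrite mulrn_wge0// mulr_ge0 ?sqrtr_ge0// ltW.
Qed.

(** Above the level [sqrt p] the root of V falls at rate [eps / 2], so it is at most
    [max (sqrt p) (sqrt (V 0) - eps / 2 * T)]; the second term is nonpositive for the times
    considered. The rate is uniform in [n] and in the trajectory. *)
Lemma error_bound {R : realType} (l1 l2 m g b : R) : 0 < l1 -> 1 < l2 ->
  8 * (l2 + 1) < l1 ^+ 2 -> 0 < m -> 2 * m ^+ 2 * (l2 + 1) < 1 ->
  l1 * m < 1 + 2 * m ^+ 2 * (l2 - 1) -> 0 < g < 1 -> b * l1 ^+ 2 = 4 ->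
  exists2 c : R, 0 < c & forall (n : R) (z1 z2 : R -> R), 0 <= n ->
    (forall T : R, 0 <= T -> exists K : R, forall s t,
       0 <= s <= T -> 0 <= t <= T ->
       `|z1 t - z1 s| <= K * `|t - s| /\ `|z2 t - z2 s| <= K * `|t - s|) ->
    {ae @lebesgue_measure R, forall t, 0 < t -> exists v1 v2 : R,
       [/\ error_field l1 l2 n (z1 t) (z2 t) v1 v2,
           right_diff z1 t v1 & right_diff z2 t v2]} ->
    forall t, Num.sqrt (lyap (m ^+ 2) b (z1 0) (z2 0)) / c <= t ->
      lyap (m ^+ 2) b (z1 t) (z2 t) * (1 - g ^+ 2) <= n.
Proof.
move=> l10 l21 l1l2 m0 m_l2 m_l1 /andP[g0 g1] bE.
have [eps eps0 dec] := decay l10 l21 l1l2 m0 m_l2 m_l1 g0 bE.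
have b0 : 0 <= b.
  by rewrite ltW// -(pmulr_lgt0 _ (exprn_gt0 2 l10)) bE.
have a0 : 0 <= m ^+ 2 by rewrite sqr_ge0.
have g21 : 0 < 1 - g ^+ 2 by rewrite subr_gt0 expr_lt1// ltW.
exists (eps / 2); first by rewrite divr_gt0.
move=> n z1 z2 n0 lip ae_ode T.
pose ode_at t := exists v1 v2 : R, [/\ error_field l1 l2 n (z1 t) (z2 t) v1 v2,
  right_diff z1 t v1 & right_diff z2 t v2].
pose E : set R := ~` [set t | 0 < t -> ode_at t].
have negE : (@lebesgue_measure R).-negligible E by exact: ae_ode.
have ode t : 0 < t -> ~ E t -> ode_at t by move=> t0 /contrapT; exact.
pose V t := lyap (m ^+ 2) b (z1 t) (z2 t).
have V0 t : 0 <= V t by exact: lyap_ge0.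
rewrite -/(V 0) -/(V T) ler_pdivrMr ?divr_gt0// => VT.
have T0 : 0 <= T.
  by rewrite -(pmulr_lge0 _ (divr_gt0 eps0 (ltr0Sn R 1))) (le_trans _ VT)// sqrtr_ge0.
(* The level [n / (1 - g ^ 2)] may be 0, so it is approached by positive [p], which keeps the root
   differentiable above the level. *)
suff main p : 0 < p -> n <= (1 - g ^+ 2) * p -> V T <= p.
  rewrite -ler_pdivlMr//; apply/ler_addgt0Pr => e e0; apply: main.
    by rewrite ltr_wpDl// divr_ge0// ltW.
  by rewrite mulrDr mulrC divfK ?gt_eqF// lerDl mulr_ge0// ltW.
move=> p0 np.
have sp0 : 0 < Num.sqrt p by rewrite sqrtr_gt0.
(* This Lipschitz bound yields both the continuity of the root of V and the crude slope on the
   exceptional set. *)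
have [K Kp Klip] : exists2 K : R, 0 <= K & forall s t, 0 <= s <= T -> 0 <= t <= T ->
    V t <= V s + K * `|t - s|.
  have [K0 H0] := lip T T0.
  pose K := `|K0|; have Kge0 : 0 <= K by exact: normr_ge0.
  have H s t : 0 <= s <= T -> 0 <= t <= T ->
      `|z1 t - z1 s| <= K * `|t - s| /\ `|z2 t - z2 s| <= K * `|t - s|.
    move=> sT tT; have [h1 h2] := H0 s t sT tT.
    have : K0 * `|t - s| <= K * `|t - s| by rewrite ler_wpM2r// ler_norm.
    by split; [exact: le_trans h1 _|exact: le_trans h2 _].
  pose M := `|z2 0| + K * T.
  have M0 : 0 <= M by rewrite addr_ge0// mulr_ge0.
  have z2M t : 0 <= t <= T -> `|z2 t| <= M.
    move=> tT; have [_] := H 0 t (ltac:(by rewrite lexx)) tT.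
    move/andP: tT => [t0 tT]; rewrite subr0 (ger0_norm t0) => h.
    rewrite -(subrKC (z2 0) (z2 t)) (le_trans (ler_normD _ _))// lerD2l.
    by rewrite (le_trans h)// ler_wpM2l.
  exists ((4 * (m ^+ 2 + b) * M + 1) * K).
    by rewrite mulr_ge0// addr_ge0// mulr_ge0// mulr_ge0// addr_ge0.
  move=> s t sT tT; have [h1 h2] := H s t sT tT.
  by rewrite -mulrA; apply: lyap_lip => //; exact: z2M.
have wT : Num.sqrt (V T) <= Num.max (Num.sqrt p) (Num.sqrt (V 0) - eps / 2 * T).
  (* The crude slope divides [K] by [2 sqrt p], the tangent factor at the level. The time 0 joins
     the exceptional set because the inclusion is known for [t > 0]. *)
  apply: (@dini_barrier R (fun t => Num.sqrt (V t)) T (eps / 2)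
    (K / (2 * Num.sqrt p)) (Num.sqrt p) (E `|` [set 0])) => //.
  - by rewrite divr_ge0// ltW.
  - move=> t t0 tT e e0.
    have K1 : 0 < K + 1 by rewrite ltr_wpDl.
    exists (e ^+ 2 / (K + 1)); first by rewrite divr_gt0// exprn_gt0.
    move=> s s0 sT; rewrite ltr_pdivlMr// => st.
    have Ke : K * `|s - t| < e ^+ 2.
      by apply: le_lt_trans st; rewrite mulrC ler_wpM2l// lerDl.
    have sT' : 0 <= s <= T by rewrite s0.
    have tT' : 0 <= t <= T by rewrite t0.
    rewrite ltr_norml ltrBlDl ltrBrDl; apply/andP; split.
      rewrite ltrBlDr; apply: sqrt_lt_addr => //.
      by rewrite (le_lt_trans (Klip _ _ sT' tT'))// ltrD2l distrC.
    apply: sqrt_lt_addr => //.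
    by rewrite (le_lt_trans (Klip _ _ tT' sT'))// ltrD2l.
  - apply: negligibleU => //; exists [set 0]; split => //.
    exact: lebesgue_measure_set1.
  - move=> t t0 tT pV /not_orP[nE /eqP t0'] s s0.
    have {}t0 : 0 < t by rewrite lt_neqAle eq_sym t0' t0.
    have [v1 [v2 [ef Z1 Z2]]] := ode t t0 nE.
    set r := Num.sqrt (V t) in pV *.
    have r0 : 0 < r by exact: lt_trans pV.
    have r2 : r ^+ 2 = V t by rewrite sqr_sqrtr.
    have gr : g ^+ 2 * r ^+ 2 <= r ^+ 2 - n.
      have : p < r ^+ 2 by rewrite r2 -ltr_sqrt// -sqrtr_gt0.
      move=> /ltW /(ler_wpM2l (ltW g21)).
      by lra.
    have [dA dB] := dec n r _ _ _ _ n0 r0 gr ef.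
    have [_ dC] := dec n r _ _ _ _ n0 r0 gr (error_fieldN _ _ _ _ _ _ _ ef).
    have lB : sqabs (m ^+ 2) b (z2 t) - z1 t <= r ^+ 2.
      by rewrite r2 /V /lyap !le_max lexx orbT.
    have lC : sqabs (m ^+ 2) b (- z2 t) + z1 t <= r ^+ 2.
      by rewrite r2 /V /lyap !le_max lexx !orbT.
    (* Division by [2 r] in the tangent bound turns the surplus [2 r s] into [s] and the rate
       [eps r] into [eps / 2]. *)
    have rs : 0 < 2 * r * s by rewrite !mulr_gt0.
    have := lyap_dini (m ^+ 2) b (eps * r) t v1 v2 z1 z2 a0 b0 Z1 Z2.
    rewrite -/(V t) -r2 => /(_ (fun h => dA h lB lC) dB).
    rewrite !opprK in dC; move=> /(_ dC (2 * r * s) rs) near_V.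
    near=> h; have h0 : 0 < h by [].
    have Vh : V (t + h) <= r ^+ 2 + (2 * r * s - eps * r) * h.
      by near: h; exact: near_V.
    rewrite (le_trans (sqrt_tangent r _ r0 (V0 _)))// lerD2l.
    rewrite ler_pdivrMr ?mulr_gt0//.
    by move: Vh; lra.
  - move=> t t0 tT pV.
    set r := Num.sqrt (V t) in pV *.
    have r0 : 0 < r by exact: lt_trans pV.
    have r2 : r ^+ 2 = V t by rewrite sqr_sqrtr.
    near=> h; have h0 : 0 < h by [].
    have hT : 0 <= t + h <= T.
      rewrite addr_ge0 ?(ltW h0)//= -lerBrDl; near: h; apply: nbhs_right_le.
      by rewrite subr_gt0.
    have tT' : 0 <= t <= T by rewrite t0 ltW.
    have E' : t + h - t = h by rewrite addrC addKr.
    have := Klip _ _ tT' hT; rewrite E' (gtr0_norm h0) -r2 => Vh.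
    rewrite (le_trans (sqrt_tangent r _ r0 (V0 _)))// lerD2l.
    rewrite (@le_trans _ _ (K * h / (2 * r)))//.
      rewrite ler_wpM2r ?invr_ge0 ?mulr_ge0 ?(ltW r0)//.
      by move: Vh; lra.
    rewrite mulrAC ler_wpM2r ?(ltW h0)// ler_wpM2l// lef_pV2 ?posrE ?mulr_gt0//.
    by rewrite ler_pM2l// ltW.
have : Num.sqrt (V T) <= Num.sqrt p.
  apply: (le_trans wT); rewrite ge_max lexx /=.
  by rewrite (@le_trans _ _ 0) ?(ltW sp0)// subr_le0 mulrC.
by rewrite ler_sqrt ?(ltW p0).
Unshelve. all: by end_near. Qed.

(** * Filippov sets of the differentiator *)

(** A closed half-plane is convex and closed. Linear bounds of this kind are the only access made to
    Filippov sets. *)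
Lemma conv_hull_halfspace {R : realType} (A : set (R * R)) (a b c : R) v :
  (forall p, A p -> a * p.1 + b * p.2 <= c) ->
  closure (conv_hull A) v -> a * v.1 + b * v.2 <= c.
Proof.
move=> Ac; pose f (p : R * R) := a * p.1 + b * p.2.
have cf : continuous f.
  move=> p; apply: cvgD; apply: cvgM; try exact: cvg_cst.
    exact: cvg_fst.
  exact: cvg_snd.
have cC : closed [set p | f p <= c].
  by have := closed_comp (fun p _ => cf p) (@closed_le R c).
move=> cv; have : closure [set p | f p <= c] v.
  apply: closure_subset cv => _ [n [w [p [w0 [w1 [Ap ->]]]]]] /=.
  rewrite /f -[_.1]/(fst (\sum_(i < n) w i *: p i)).
  rewrite -[X in b * X]/(snd (\sum_(i < n) w i *: p i)) !raddf_sum/= !mulr_sumr -big_split/=.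
  rewrite -[c]mul1r -w1 mulr_suml; apply: ler_sum => i _.
  rewrite (_ : _ + _ = w i * (a * (p i).1 + b * (p i).2)).
    by apply: ler_wpM2l => //; exact: Ac.
  by rewrite /GRing.scale/=; ring.
by rewrite -(closure_id _).1.
Qed.

Lemma filippov_halfspace {R : realType} (F : R -> R * R -> R * R) (t : R)
    (x v : R * R) (a b c d : R) : 0 < d ->
  (forall y, ball x d y -> a * (F t y).1 + b * (F t y).2 <= c) ->
  filippov_set F t x v -> a * v.1 + b * v.2 <= c.
Proof.
move=> d0 Fc /(_ d set0 d0 (negligible_set0 _)).
by apply: conv_hull_halfspace => _ [y [xy _] <-]; exact: Fc.
Qed.

(** Since [Num.sqrt] vanishes on negative numbers, this form shows continuity across 0. *)
Lemma spow_half {R : realType} (z : R) :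
  spow z 2^-1 = Num.sqrt z - Num.sqrt (- z).
Proof.
rewrite /spow powR12_sqrt// ; have [z0|z0|->] := ltgtP z 0.
- by rewrite ltr0_norm// ltr0_sg// (ler0_sqrtr (ltW z0)) mulrN1 sub0r.
- by rewrite gtr0_norm// gtr0_sg// (@ler0_sqrtr _ (- z)) ?mulr1 ?subr0// oppr_le0 ltW.
- by rewrite sgr0 mulr0 oppr0 subrr.
Qed.

Lemma spow0 {R : realType} (z : R) : spow z 0 = Num.sg z.
Proof. by rewrite /spow powRr0 mul1r. Qed.

(** At frozen [t] the first component is continuous in the state, so it takes a single value. The
    second is bounded by [l2 * L], and constant near [x] unless [e = 0]. *)
Lemma filippov_sta {R : realType} (l1 l2 L : R) (u : R -> R) (t : R)
    (x v : R * R) : 0 < l2 -> 0 < L ->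
  filippov_set (sta_rhs l1 l2 L u) t x v ->
  let e := u t - x.1 in
  v.1 = l1 * Num.sqrt L * spow e 2^-1 + x.2 /\
  exists s, [/\ v.2 = l2 * L * s, `|s| <= 1, 0 < e -> s = 1 & e < 0 -> s = -1].
Proof.
move=> l20 L0 Fv e; pose c := l2 * L; have c0 : 0 < c by rewrite mulr_gt0.
pose p (y : R * R) := l1 * Num.sqrt L * spow (u t - y.1) 2^-1 + y.2.
split.
  have cp : {for x, continuous p}.
    apply: cvgD; last exact: cvg_snd.
    apply: cvgM; first exact: cvg_cst.
    have h : (u t - y.1) @[y --> x] --> u t - x.1.
      by apply: cvgB; [exact: cvg_cst|exact: cvg_fst].
    under eq_fun do rewrite spow_half.
    rewrite spow_half; apply: cvgB.
      by apply: continuous_cvg h; exact: sqrt_continuous.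
    by apply: continuous_cvg (cvgN h); exact: sqrt_continuous.
  apply/eqP; rewrite -subr_eq0 -normr_le0; apply/ler_addgt0Pr => k k0.
  rewrite add0r.
  have : \forall y \near x, `|p x - p y| < k by move/cvgrPdist_lt : cp; exact.
  move=> /nbhs_ballP[d /= d0 xd].
  rewrite ler_norml; apply/andP; split.
    have := @filippov_halfspace _ _ t x v (-1) 0 (k - p x) d d0 _ Fv.
    rewrite /p mul0r addr0 mulN1r -/e => h; suff : - v.1 <= k - p x by rewrite /p -/e; lra.
    apply: h => y xy; rewrite mul0r addr0 mulN1r/= -/(p y) -/(p x).
    by have := xd y xy; rewrite /= ltr_norml => /andP[_]; lra.
  have := @filippov_halfspace _ _ t x v 1 0 (k + p x) d d0 _ Fv.
  rewrite mul0r addr0 mul1r => h; suff : v.1 <= k + p x by rewrite /p -/e; lra.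
  apply: h => y xy; rewrite mul0r addr0 mul1r/= -/(p y).
  by have := xd y xy; rewrite /= ltr_norml => /andP[]; lra.
(* Half-plane bounds on the second component; for [e <> 0] they are applied on a ball of radius
   [|e|], where the sign cannot change. *)
have bnd a k d : 0 < d -> (forall y, ball x d y -> a * Num.sg (u t - y.1) <= k) ->
    a * v.2 <= c * k.
  move=> d0 H; have := @filippov_halfspace _ _ t x v 0 a (c * k) d d0 _ Fv.
  rewrite mul0r add0r; apply => y xy; rewrite mul0r add0r/= spow0.
  by rewrite mulrCA ler_pM2l//; exact: H.
have sg1 (z : R) : -1 <= Num.sg z <= 1.
  by rewrite -ler_norml normr_sg; case: (z != 0); rewrite ?lexx ?ler01.
have up : v.2 <= c.
  have := bnd 1 1 1 ltr01; rewrite mul1r mulr1; apply => y _.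
  by rewrite mul1r; case/andP: (sg1 (u t - y.1)).
have lo : - c <= v.2.
  have := bnd (-1) 1 1 ltr01; rewrite mulN1r mulr1 => h; rewrite lerNl.
  by apply: h => y _; rewrite mulN1r lerNl; case/andP: (sg1 (u t - y.1)).
have vE : v.2 = c * (v.2 / c) by rewrite mulrC divfK// gt_eqF.
exists (v.2 / c); split => //.
- by rewrite ler_norml ler_pdivlMr// ler_pdivrMr// mulN1r mul1r lo.
- move=> e0; have : c <= v.2.
    have := bnd (-1) (-1) e e0; rewrite mulN1r mulrN1 lerN2; apply => y [xy _].
    rewrite gtr0_sg ?mulr1//; move: xy; rewrite /ball/= ltr_norml => /andP[].
    by rewrite /e; lra.
  by move=> cv; rewrite (_ : v.2 = c) ?divff ?gt_eqF//; apply/le_anti/andP.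
- move=> e0; have : v.2 <= - c.
    have ne0 : 0 < - e by rewrite oppr_gt0.
    have := bnd 1 (-1) (- e) ne0; rewrite mul1r mulrN1; apply => y [xy _].
    rewrite ltr0_sg ?mul1r//; move: xy; rewrite /ball/= ltr_norml => /andP[].
    by rewrite /e; lra.
  move=> cv; rewrite (_ : v.2 = - c) ?mulNr ?divff ?gt_eqF//.
  by apply/le_anti/andP.
Qed.

(** * Indefinite Lebesgue integrals *)

Definition primitive {R : realType} (g y : R -> R) : Prop :=
  forall t, 0 <= t ->
    (@lebesgue_measure R).-integrable `[0%R, t] (fun s => (g s)%:E) /\
    ((y t - y 0)%:E = \int[@lebesgue_measure R]_(s in `[0%R, t]) (g s)%:E)%E.

Lemma primitive_itv {R : realType} (g y : R -> R) (s t : R) :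
  primitive g y -> 0 <= s -> s <= t ->
  (@lebesgue_measure R).-integrable `]s, t] (fun x => (g x)%:E) /\
  ((y t - y s)%:E = \int[@lebesgue_measure R]_(x in `]s, t]) (g x)%:E)%E.
Proof.
move=> P s0 st; have t0 : 0 <= t by exact: le_trans st.
have [gt yt] := P t t0; have [gs ys] := P s s0.
have sub : `]s, t] `<=` `[0, t] by apply: subset_itvr; rewrite bnd_simp.
have gst : (@lebesgue_measure R).-integrable `]s, t] (fun x => (g x)%:E).
  by apply: integrableS gt.
split => //.
have E : `[0, t]%classic = `[0, s] `|` `]s, t].
  by rewrite (@itv_bndbnd_setU _ _ _ (BRight s))//= bnd_simp.
move: yt; rewrite E integral_setU//=.
- have /fineK If : (\int[@lebesgue_measure R]_(x in `]s, t]) (g x)%:E \is a fin_num)%E.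
    exact: integrable_fin_num.
  rewrite -ys -If //= -EFinD => -[yt]; congr EFin; lra.
- by rewrite -E; case/integrableP: gt.
- apply/disj_setPLR => x /=; rewrite !in_itv/= => /andP[_ xs].
  by apply/negP; rewrite negb_and -leNgt xs.
Qed.

Lemma primitive_lip {R : realType} (g y : R -> R) (B s t : R) :
  primitive g y -> 0 <= s -> s <= t -> 0 <= B ->
  {ae @lebesgue_measure R, forall x, s < x <= t -> `|g x| <= B} ->
  `|y t - y s| <= B * (t - s).
Proof.
move=> P s0 st B0 gB; have [ig E] := primitive_itv _ _ _ _ P s0 st.
have mg := measurable_int _ ig.
rewrite -lee_fin -[leLHS]/(`|(y t - y s)%:E|)%E E.
apply: le_trans (le_abse_integral _ _ mg) _ => //.
apply: (@le_trans _ _ (\int[@lebesgue_measure R]_(x in `]s, t]) cst B%:E x)%E).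
  apply: ae_ge0_le_integral => //.
  exact: measurableT_comp.
rewrite integral_cst//.
have muE : @lebesgue_measure R (`]s, t]%classic : set R) = (t - s)%:E.
  rewrite lebesgue_measure_itv/= lte_fin; case: ltP => [_|ts]; first by rewrite -EFinD.
  by congr EFin; apply/esym/eqP; rewrite subr_eq0 eq_le ts.
by rewrite [X in (_ * X)%E]muE -EFinM.
Qed.

(** The bound comes from the integral of [|g|]. It has to come before any pointwise bound on [g],
    which for the differentiator depends on the size of [y]. *)
Lemma primitive_bounded {R : realType} (g y : R -> R) (T : R) :
  primitive g y -> 0 <= T ->
  exists2 M, 0 <= M & forall t, 0 <= t <= T -> `|y t| <= M.
Proof.
move=> P T0; have [/integrableP[mg gfin] _] := P T T0.
pose I := (\int[@lebesgue_measure R]_(x in `[0%R, T]) `|(g x)%:E|)%E.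
have I0 : (0 <= I)%E by exact: integral_ge0.
have If : I \is a fin_num by rewrite ge0_fin_numE.
exists (`|y 0| + fine I); first by rewrite addr_ge0// fine_ge0.
move=> t /andP[t0 tT]; rewrite -(subrKC (y 0) (y t)) (le_trans (ler_normD _ _))// lerD2l.
rewrite -lee_fin fineK//.
have [ig E] := P t t0.
rewrite -[leLHS]/(`|(y t - y 0)%:E|)%E E.
apply: le_trans (le_abse_integral _ _ (measurable_int _ ig)) _ => //.
apply: ge0_subset_integral => //.
- exact: measurableT_comp.
- by apply: subset_itvl; rewrite bnd_simp.
Qed.

Lemma derivable_right_diff {R : realType} (z : R -> R) (t : R) :
  derivable z t 1 -> right_diff z t (derive1 z t).
Proof.
rewrite derive1E /derivable /derive => dz s s0.
set v := lim _ in dz *.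
have : \forall h \near (0:R)^', `|v - h^-1 *: ((z \o shift t) (h *: 1) - z t)| <= s.
  by move/cvgrPdist_le : dz; exact.
move=> [d /= d0 H]; near=> h.
have h0 : 0 < h by [].
have hd : h < d by [].
have {H} := H h; rewrite /= sub0r normrN (gtr0_norm h0) => /(_ hd).
rewrite gt_eqF// => /(_ isT).
rewrite -[h *: 1]/(h * 1) mulr1 -[_ *: _]/(h^-1 * _) [h + t]addrC => H.
rewrite distrC (_ : _ - _ = h * (v - h^-1 * (z (t + h) - z t))).
  by rewrite normrM (gtr0_norm h0) mulrC ler_pM2r.
by rewrite mulrBr mulrA divff ?gt_eqF// mul1r.
Unshelve. all: by end_near. Qed.

Lemma eq_near_right_diff {R : realType} (z w : R -> R) (c t d v : R) : 0 < d ->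
  (forall x, `|x - t| < d -> z x = c + w x) -> right_diff w t v ->
  right_diff z t v.
Proof.
move=> d0 zw wv s s0; near=> h.
have h0 : 0 < h by [].
have hd : h < d by [].
rewrite (zw (t + h)); last by rewrite addrC addKr gtr0_norm.
rewrite (zw t) ?subrr ?normr0// opprD addrACA subrr add0r.
by near: h; exact: wv.
Unshelve. all: by end_near. Qed.

(** Lebesgue differentiation on each [[0, n]], with [g] cut off outside to be integrable on the
    line; the countably many null sets are then united. *)
Lemma primitive_right_diff {R : realType} (g y : R -> R) : primitive g y ->
  {ae @lebesgue_measure R, forall x, 0 < x -> right_diff y x (g x)}.
Proof.
move=> P; pose mu := @lebesgue_measure R.
have H (n : nat) : {ae mu, forall x : R, 0 < x -> x < n%:R -> right_diff y x (g x)}.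
  have [gn _] := P n%:R (ler0n _ n).
  pose f := g \_ `[0, n%:R].
  have intf : mu.-integrable setT (EFin \o f).
    have := gn; rewrite integrable_mkcond//; congr is_true; congr (mu.-integrable _ _).
    by apply/funext => x; rewrite /f /= !patchE; case: ifPn.
  have locf : locally_integrable setT f by apply: integrable_locally.
  have intf' x : mu.-integrable [set` Interval (BLeft 0) (BRight x)] (EFin \o f).
    by apply: integrableS intf.
  have := FTC1 intf' locf; apply: filterS; first exact: (ae_filter_ringOfSetsType mu).
  move=> x Hx x0 xn; have [] := Hx; first by rewrite lte_fin.
  move=> /derivable_right_diff + E; rewrite E.
  have -> : f x = g x by rewrite /f patchE mem_set//= in_itv/= !ltW.
  pose d := Num.min x (n%:R - x).
  have d0 : 0 < d by rewrite lt_min x0 subr_gt0.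
  apply: (@eq_near_right_diff _ _ _ (y 0) _ d) => // t.
  rewrite /d lt_min => /andP[xt tn].
  have t0 : 0 <= t by move: xt; rewrite ltr_norml => /andP[+ _]; lra.
  have {}tn : t <= n%:R by move: tn; rewrite ltr_norml => /andP[_]; lra.
  have [_ Et] := P t t0.
  suff : y t - y 0 = Rintegral mu `[0, t] f by move=> <-; rewrite subrKC.
  rewrite /Rintegral; transitivity (fine (y t - y 0)%:E) => //; congr fine.
  rewrite Et; apply: eq_integral => s; rewrite inE/= in_itv/= => /andP[s0 st].
  by rewrite /f patchE mem_set//= in_itv/= s0 (le_trans st).
have := ae_foralln H; apply: filterS.
move=> x Hx x0; have [n xn] : exists n : nat, x < n%:R.
  by exists (Num.bound x); apply: archi_boundP; exact: ltW.
exact: Hx n x0 xn.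
Qed.

(** * The differentiation error *)

Lemma derivable_lip {R : realType} (f : R -> R) (M T s t : R) :
  (forall x, 0 <= x -> derivable f x 1) ->
  (forall x, 0 <= x <= T -> `|derive1 f x| <= M) ->
  0 <= s <= T -> 0 <= t <= T -> `|f t - f s| <= M * `|t - s|.
Proof.
move=> df fM; wlog st : s t / s <= t.
  move=> H sT tT; have [st|/ltW ts] := leP s t; first exact: H.
  by rewrite distrC (distrC t); exact: H.
move=> /andP[s0 sT] /andP[t0 tT].
have dfi x : x \in `]s, t[ -> is_derive x 1 f (derive1 f x).
  rewrite in_itv/= => /andP[sx _]; rewrite derive1E; apply: derivableP.
  by apply: df; rewrite (le_trans s0)// ltW.
have cf : {within `[s, t], continuous f}.
  apply: derivable_within_continuous => x; rewrite in_itv/= => /andP[sx _].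
  by apply: df; exact: le_trans sx.
have [c] := MVT_segment st dfi cf.
rewrite in_itv/= => /andP[sc ct] ->; rewrite normrM ler_wpM2r// fM//.
by rewrite (le_trans s0 sc) (le_trans ct tT).
Qed.

Lemma primitive_lip_sym {R : realType} (g y : R -> R) (B T s t : R) :
  primitive g y -> 0 <= B ->
  {ae @lebesgue_measure R, forall x, 0 < x <= T -> `|g x| <= B} ->
  0 <= s <= T -> 0 <= t <= T -> `|y t - y s| <= B * `|t - s|.
Proof.
move=> P B0 gB; wlog st : s t / s <= t.
  move=> H sT tT; have [st|/ltW ts] := leP s t; first exact: H.
  by rewrite distrC (distrC t); exact: H.
move=> /andP[s0 sT] /andP[t0 tT].
rewrite (ger0_norm (_ : 0 <= t - s)) ?subr_ge0//.
apply: (primitive_lip _ _ _ _ _ P s0 st B0).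
move: gB; apply: filterS; first exact: (ae_filter_ringOfSetsType (@lebesgue_measure R)).
move=> x H /andP[sx xt]; apply: H.
by rewrite (le_lt_trans s0 sx) (le_trans xt tT).
Qed.

Lemma right_diffB {R : realType} (z w : R -> R) (t v v' : R) :
  right_diff z t v -> right_diff w t v' ->
  right_diff (fun x => z x - w x) t (v - v').
Proof.
move=> Z W s s0; have s20 : 0 < s / 2 by rewrite divr_gt0.
near=> h.
have zh : `|z (t + h) - z t - h * v| <= s / 2 * h by near: h; exact: Z.
have wh : `|w (t + h) - w t - h * v'| <= s / 2 * h by near: h; exact: W.
rewrite (_ : _ - _ = (z (t + h) - z t - h * v) - (w (t + h) - w t - h * v')); last by ring.
by rewrite (le_trans (ler_normB _ _))// (le_trans (lerD zh wh))// -mulrDl -splitr.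
Unshelve. all: by end_near. Qed.

Lemma right_diffZ {R : realType} (z : R -> R) (c t v : R) : 0 < c ->
  right_diff z t v -> right_diff (fun x => z x / c) t (v / c).
Proof.
move=> c0 Z s s0; have sc0 : 0 < s * c by rewrite mulr_gt0.
near=> h.
have zh : `|z (t + h) - z t - h * v| <= s * c * h by near: h; exact: Z.
rewrite (_ : _ - _ = (z (t + h) - z t - h * v) / c); last by ring.
by rewrite normrM normfV (gtr0_norm c0) ler_pdivrMr// mulrAC.
Unshelve. all: by end_near. Qed.

(** Homogeneity of degree one half, which removes [L] from the normalised error system. *)
Lemma spow_scale {R : realType} (L e : R) : 0 < L ->
  Num.sqrt L * spow (L * e) 2^-1 = L * (Num.sg e * Num.sqrt `|e|).
Proof.
move=> L0; rewrite /spow powR12_sqrt// normrM sgrM gtr0_sg// mul1r gtr0_norm//.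
rewrite sqrtrM ?ltW// !mulrA -expr2 sqr_sqrtr ?ltW//.
exact: mulrAC.
Qed.

Lemma spow_half_le {R : realType} (e : R) : `|spow e 2^-1| <= Num.sqrt `|e|.
Proof.
rewrite /spow powR12_sqrt// normrM ger0_norm ?sqrtr_ge0// ler_piMr ?sqrtr_ge0//.
by rewrite normr_sg; case: (e != 0); rewrite ?ler01 ?lexx.
Qed.

Section error.
Context {R : realType} {l1 l2 L N : R} {f eta : R -> R} {y : R -> R * R}.
Context (L0 : 0 < L) (l10 : 0 < l1) (l20 : 0 < l2).
Context (fF : class_F L f) (etaE : class_E N eta).
Context (ys : filippov_solution (sta_rhs l1 l2 L (fun t => f t + eta t)) y).

Let z1 t := ((y t).1 - f t) / L.
Let z2 t := ((y t).2 - derive1 f t) / L.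

(** A bootstrap: [y] is bounded on [[0, T]] as an integral, hence its velocity is essentially
    bounded by the Filippov inclusion, hence [y] is Lipschitz there. *)
Lemma error_lip T : 0 <= T -> exists K : R, forall s t,
  0 <= s <= T -> 0 <= t <= T ->
  `|z1 t - z1 s| <= K * `|t - s| /\ `|z2 t - z2 s| <= K * `|t - s|.
Proof.
move=> T0; have [df [[K0 fK0] _]] := fF; have [_ eN] := etaE.
have [g [gP gF]] := ys.
have P1 : primitive (fun t => (g t).1) (fun t => (y t).1).
  by move=> t t0; have [? [_ [? _]]] := gP t t0.
have P2 : primitive (fun t => (g t).2) (fun t => (y t).2).
  by move=> t t0; have [_ [? [_ ?]]] := gP t t0.
have [M1 M10 y1M] := primitive_bounded _ _ _ P1 T0.
have [M2 M20 y2M] := primitive_bounded _ _ _ P2 T0.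
have dist0 t : 0 <= t <= T -> `|t - 0| <= T.
  by rewrite subr0 => /andP[t0 tT]; rewrite ger0_norm.
have T00 : (0 : R) <= 0 <= T by apply/andP.
pose K := `|K0|; have Kp : 0 <= K by exact: normr_ge0.
have f'K s t : 0 <= s <= T -> 0 <= t <= T ->
    `|derive1 f t - derive1 f s| <= K * `|t - s|.
  move=> /andP[s0 _] /andP[t0 _]; apply: (le_trans (fK0 t s t0 s0)).
  by rewrite ler_wpM2r// ler_norm.
have bd (h : R -> R) (B : R) : 0 <= B -> (forall s t, 0 <= s <= T -> 0 <= t <= T ->
    `|h t - h s| <= B * `|t - s|) -> forall t, 0 <= t <= T -> `|h t| <= `|h 0| + B * T.
  move=> B0 H t tT; rewrite -(subrKC (h 0) (h t)) (le_trans (ler_normD _ _))//.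
  by rewrite lerD2l (le_trans (H _ _ T00 tT))// ler_wpM2l// dist0.
pose F1 := `|derive1 f 0| + K * T.
have F10 : 0 <= F1 by rewrite addr_ge0// mulr_ge0.
have fF1 s t : 0 <= s <= T -> 0 <= t <= T -> `|f t - f s| <= F1 * `|t - s|.
  by apply: derivable_lip => //; exact: bd.
pose F0 := `|f 0| + F1 * T.
have fF0 := bd f F1 F10 fF1.
pose B1 := l1 * Num.sqrt L * Num.sqrt (F0 + N + M1) + M2.
have lL0 : 0 <= l1 * Num.sqrt L by rewrite mulr_ge0 ?sqrtr_ge0// ltW.
have B10 : 0 <= B1 by rewrite addr_ge0// mulr_ge0// sqrtr_ge0.
pose B2 := l2 * L.
have B20 : 0 <= B2 by rewrite mulr_ge0// ltW.
have g1B : {ae @lebesgue_measure R, forall x, 0 < x <= T -> `|(g x).1| <= B1}.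
  move: gF; apply: filterS; first exact: (ae_filter_ringOfSetsType (@lebesgue_measure R)).
move=> x Fx /andP[x0 xT].
  have x0T : 0 <= x <= T by rewrite (ltW x0).
  have [-> _] := filippov_sta _ _ _ _ _ _ _ l20 L0 (Fx (ltW x0)).
  rewrite (le_trans (ler_normD _ _))// lerD ?y2M// normrM (ger0_norm lL0).
  rewrite ler_wpM2l// (le_trans (spow_half_le _))// ler_wsqrtr//.
  rewrite (le_trans (ler_normB _ _))// lerD ?y1M//.
  by rewrite (le_trans (ler_normD _ _))// lerD ?fF0// eN// ltW.
have g2B : {ae @lebesgue_measure R, forall x, 0 < x <= T -> `|(g x).2| <= B2}.
  move: gF; apply: filterS; first exact: (ae_filter_ringOfSetsType (@lebesgue_measure R)).
move=> x Fx /andP[x0 xT].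
  have [_ [s [-> s1 _ _]]] := filippov_sta _ _ _ _ _ _ _ l20 L0 (Fx (ltW x0)).
  by rewrite normrM (ger0_norm B20) ler_piMr.
exists ((B1 + F1 + (B2 + K)) / L) => s t sT tT.
have y1 := primitive_lip_sym _ _ _ _ _ _ P1 B10 g1B sT tT.
have y2 := primitive_lip_sym _ _ _ _ _ _ P2 B20 g2B sT tT.
have d0 : 0 <= `|t - s| by [].
have scale (a b : R) : `|a| <= (B1 + F1 + (B2 + K)) * `|t - s| -> b = a / L ->
    `|b| <= (B1 + F1 + (B2 + K)) / L * `|t - s|.
  move=> H ->; rewrite normrM normfV (gtr0_norm L0) ler_pdivrMr//.
  by rewrite mulrAC divfK// gt_eqF.
split.
- apply: (scale (((y t).1 - (y s).1) - (f t - f s))); last by rewrite /z1; ring.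
  rewrite (le_trans (ler_normB _ _))// mulrDl mulrDl -[leLHS]addr0.
  by rewrite lerD ?(lerD y1 (fF1 s t sT tT))// mulr_ge0// addr_ge0.
- apply: (scale (((y t).2 - (y s).2) - (derive1 f t - derive1 f s))); last by rewrite /z2; ring.
  rewrite (le_trans (ler_normB _ _))// mulrDl [X in _ <= _ + X]mulrDl -[leLHS]add0r.
  by rewrite lerD ?(lerD y2 (f'K s t sT tT))// mulr_ge0// addr_ge0.
Qed.

(** Off a null set three facts hold together: [y] has the right derivative [g], the second
    derivative of [f] exists with modulus at most [L], and [g] lies in the Filippov set. *)
Lemma error_ode : {ae @lebesgue_measure R, forall t, 0 < t -> exists v1 v2 : R,
  [/\ error_field l1 l2 (N / L) (z1 t) (z2 t) v1 v2,
      right_diff z1 t v1 & right_diff z2 t v2]}.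
Proof.
have [df [_ ddf]] := fF; have [_ eN] := etaE; have [g [gP gF]] := ys.
have P1 : primitive (fun t => (g t).1) (fun t => (y t).1).
  by move=> t t0; have [? [_ [? _]]] := gP t t0.
have P2 : primitive (fun t => (g t).2) (fun t => (y t).2).
  by move=> t t0; have [_ [? [_ ?]]] := gP t t0.
have FF := ae_filter_ringOfSetsType (@lebesgue_measure R).
have D12 := @filterI _ _ FF _ _ (primitive_right_diff _ _ P1)
  (primitive_right_diff _ _ P2).
have G := @filterI _ _ FF _ _ ddf gF.
refine (@filterS _ _ FF _ _ _ (@filterI _ _ FF _ _ G D12)).
move=> t [[ddt gt] [D1 D2]] t0.
have [dd1 dd2] := ddt t0.
have [E1 [s [E2 s1 sp sn]]] := filippov_sta _ _ _ _ _ _ _ l20 L0 (gt (ltW t0)).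
exists (((g t).1 - derive1 f t) / L), (((g t).2 - derive1 (derive1 f) t) / L).
split; last 2 first.
- apply: right_diffZ => //; apply: right_diffB; first exact: D1.
  by apply: derivable_right_diff; apply: df; exact: ltW.
- apply: right_diffZ => //; apply: right_diffB; first exact: D2.
  exact: derivable_right_diff.
have Ln0 : L != 0 by rewrite gt_eqF.
(* This is [(u - y1) / L], so that [e + z1] is the scaled noise; the disturbance [d] below is minus
   the second derivative of [f] over [L]. *)
pose e := eta t / L - z1 t.
have Le : f t + eta t - (y t).1 = L * e by rewrite /e /z1; field.
rewrite Le in E1 sp sn.
exists e, s, (- derive1 (derive1 f) t / L); split.
- rewrite /e subrK normrM normfV (gtr0_norm L0) ler_pM2r ?invr_gt0//.
  by apply: eN; exact: ltW.
- by rewrite E1 -mulrA spow_scale// /z2; field.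
- by rewrite E2; field.
- by rewrite normrM normrN normfV (gtr0_norm L0) ler_pdivrMr// mul1r.
- split => //; first by move=> e0; apply: sp; rewrite mulr_gt0.
  by move=> e0; apply: sn; rewrite pmulr_rlt0.
Qed.

End error.

(** * The convergence time and the final bound *)

Theorem theorem1 (R : realType) (L N alpha lambda1 lambda2 : R) :
  0 < L -> 0 <= N -> 1 < alpha -> alpha <= 4 ->
  0 < lambda1 -> 0 < lambda2 ->
  1 < lambda1 / Num.sqrt (8 * (lambda2 + 1)) ->
  lambda1 / Num.sqrt (8 * (lambda2 + 1)) <
    ((alpha + 1) * lambda2 + alpha - 1) /
      (2 * Num.sqrt alpha * (lambda2 + 1)) ->
  exists tau : R -> R -> R,
    forall (f eta : R -> R), class_F L f -> class_E N eta ->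
    forall y : R -> R * R,
      filippov_solution (sta_rhs lambda1 lambda2 L (fun t => f t + eta t)) y ->
      (y 0).1 = f 0 + eta 0 -> (y 0).2 = 0 ->
      forall t, tau (derive1 f 0) (eta 0) <= t ->
        `|(y t).2 - derive1 f t| <=
          2 * Num.sqrt (alpha * (lambda2 + 1)) * Num.sqrt (N * L).
Proof.
move=> L0 N0 a1 a4 l10 l20 H1 H2.
have [l21 [l1l2 [m [g [m0 g01 m_l2 m_l1 mg]]]]] :=
  gain_exists _ _ _ a1 a4 l10 l20 H1 H2.
pose b := 4 / lambda1 ^+ 2.
have bE : b * lambda1 ^+ 2 = 4 by rewrite divfK// expf_neq0// gt_eqF.
have [c c0 bound] :=
  error_bound _ _ _ _ _ l10 l21 l1l2 m0 m_l2 m_l1 g01 bE.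
(* The initial conditions make the normalised error start at [(eta 0 / L, - f' 0 / L)]. *)
exists (fun f1 e0 => Num.sqrt (lyap (m ^+ 2) b (e0 / L) (- f1 / L)) / c).
move=> f eta fF etaE y ys y1 y2 t taut.
have := bound (N / L) _ _ (divr_ge0 N0 (ltW L0))
  (error_lip L0 l10 l20 fF etaE ys) (error_ode L0 l20 fF etaE ys) t.
rewrite y1 y2 (addrC (f 0)) addrK sub0r => /(_ taut).
set x2 := (y t).2 - derive1 f t => V.
have k0 : 0 < lambda2 + 1 by rewrite addr_gt0.
have ak0 : 0 <= alpha * (lambda2 + 1).
  by rewrite mulr_ge0 ?(ltW k0)// (le_trans ler01)// ltW.
have NL0 : 0 <= N * L by rewrite mulr_ge0// ltW.
rewrite -(@ler_pXn2r _ 2) ?nnegrE ?mulr_ge0 ?sqrtr_ge0// !exprMn.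
rewrite !sqr_sqrtr// real_normK ?num_real//.
have g20 : 0 <= 1 - g ^+ 2.
  by case/andP: g01 => g0 g1; rewrite subr_ge0 expr_le1 ?ltW.
(* The first branch of V alone controls the derivative estimate. *)
have {V} : m ^+ 2 / 2 * (x2 / L) ^+ 2 * (1 - g ^+ 2) <= N / L.
  by apply: le_trans V; rewrite ler_wpM2r// /lyap le_max lexx.
have L20 : 0 < L ^+ 2 by rewrite exprn_gt0.
rewrite ler_pdivlMr// expr_div_n => V.
have {}V : m ^+ 2 * (1 - g ^+ 2) * x2 ^+ 2 <= 2 * (N * L).
  rewrite (_ : _ * _ * _ = 2 * (m ^+ 2 / 2 * (x2 ^+ 2 / L ^+ 2) * (1 - g ^+ 2) * L) * L).
    by rewrite -mulrA ler_pM2l// ler_pM2r.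
  by field; rewrite gt_eqF.
have := ler_wpM2r (sqr_ge0 x2) mg; rewrite mul1r => /le_trans; apply.
have := ler_wpM2r ak0 V; rewrite -natrX.
by lra.
Qed.
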